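(* Let $\epsilon_0>0$, $n\ge1$, and let $A$ and $B$ be two (smooth, Hermitian) connections on the trivial bundle $\mathbb{R}^{1+3}\times\mathbb{C}^n$ over Minkowski space $\mathbb{R}^{1+3}$ such that for all $0<\epsilon<\epsilon_0$ there holds $$\mathbf{S}^A_{z\gets y\gets x}=\mathbf{S}^B_{z\gets y\gets x}\quad\text{for all }(x,y,z)\in\mathbb{S}^+(\mho(\epsilon)).$$ Then there exists a smooth map $\mathbf{u}:\mathbb{D}\to U(n)$ such that $$\mathbf{u}|_{\mho(\epsilon_0)}=\mathrm{id}\quad\text{and}\quad B=\mathbf{u}^{-1}d\mathbf{u}+\mathbf{u}^{-1}A\mathbf{u}\ \text{ on }\mathbb{D},$$ where $\mathbb{D}$ is the causal diamond of $\mho(\epsilon_0)$.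
   Context: Minkowski space is $\mathbb{R}^{1+3}$ with Cartesian coordinates $(t=x^0,x^1,x^2,x^3)$ and metric $g=-dt^2+\sum_{j=1}^3(dx^j)^2$. A (Hermitian) connection is a smooth 1-form $A=\sum_{j=0}^3A_j\,dx^j$ whose components $A_j$ are skew-Hermitian $n\times n$ matrix valued functions on $\mathbb{R}^{1+3}$. For $\epsilon>0$ let $\mho(\epsilon)=(0,1)\times B(\epsilon)$, where $B(\epsilon)$ is the open ball of radius $\epsilon$ centred at the origin of $\mathbb{R}^3$. For $x,y\in\mathbb{R}^{1+3}$ write $x\le y$ if $x=y$ or $x$ can be joined to $y$ by a future pointing causal curve, and $x<y$ if $x\le y$ and $x\ne y$. Let $\mathscr{J}^+(x)=\{y:x\le y\}$, $\mathscr{J}^-(z)=\{y:y\le z\}$ and $$\mathbb{D}=\bigcup_{x,z\in\mho(\epsilon_0)}\big(\mathscr{J}^+(x)\cap\mathscr{J}^-(z)\big).$$ Let $$\mathbb{L}=\{(x,y): \text{there is a lightlike geodesic (straight line with null direction) joining }x\text{ and }y\},$$ $$\mathbb{S}^+(\mho(\epsilon))=\{(x,y,z):(x,y),(y,z)\in\mathbb{L},\ x<y<z,\ x,z\in\mho(\epsilon),\ y\notin\mho(\epsilon)\}.$$ If $x=\gamma(s_0)$ and $y=\gamma(s_1)$ for a lightlike geodesic $\gamma$, the parallel transport map $\mathbf{P}^A_{y\gets x}:\mathbb{C}^n\to\mathbb{C}^n$ is defined by $\mathbf{P}^A_{y\gets x}v=w(s_1)$, where $w$ solves $\dot w+\langle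 A,\dot\gamma\rangle w=0$ between $s_0$ and $s_1$, $w(s_0)=v$, and $\langle\cdot,\cdot\rangle$ is the duality pairing of covectors and vectors; in Minkowski space it depends only on $x,y$ and $A$. The broken non-abelian light ray transform is $\mathbf{S}^A_{z\gets y\gets x}=\mathbf{P}^A_{z\gets y}\mathbf{P}^A_{y\gets x}$ for $(x,y,z)\in\mathbb{S}^+(\mho(\epsilon))$. $U(n)$ is the group of unitary $n\times n$ matrices. *)

(* Defs.v *)
From HB Require Import structures.
From mathcomp Require Import all_boot all_order all_algebra.
From mathcomp Require Import complex.
From mathcomp Require Import all_classical all_reals all_analysis.

Set Implicit Arguments.
Unset Strict Implicit.
Unset Printing Implicit Defensive.

Import Order.TTheory GRing.Theory Num.Theory.
Import numFieldNormedType.Exports.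

Local Open Scope classical_set_scope.
Local Open Scope ring_scope.
Local Open Scope complex_scope.
Local Open Scope sesquilinear_scope.

(* Row vectors over 'I_4; index 0 is time, indices 1, 2, 3 are space. *)
Notation spacetime R := 'rV[R]_4.

(** Smoothness and differentiation *)

Definition basis_vec (R : realType) (m : nat) (j : 'I_m) : 'rV[R]_m :=
  delta_mx 0 j.

(* Meaningful for open U: the partial derivatives at the points of U only
   depend on the restriction of f to U. *)
Fixpoint Ck_on (R : realType) (m k : nat) (U : set 'rV[R]_m)
    (f : 'rV[R]_m -> R) {struct k} : Prop :=
  (forall x, U x -> {for x, continuous f}) /\
  match k with
  | 0%N => True
  | k'.+1 => forall j : 'I_m,
      (forall x, U x -> derivable f x (basis_vec R j)) /\
      Ck_on k' U (fun x => 'D_(basis_vec R j) f x)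
  end.

Definition smooth_on (R : realType) (m : nat) (U : set 'rV[R]_m)
    (f : 'rV[R]_m -> R) : Prop :=
  forall k : nat, Ck_on k U f.

(* R[i] carries no normed module structure over R in the library, so
   differentiation of complex matrices along real directions is done on the
   real and imaginary parts of the entries. *)
Definition mx_smooth_on (R : realType) (m p q : nat) (U : set 'rV[R]_m)
    (F : 'rV[R]_m -> 'M[R[i]]_(p, q)) : Prop :=
  forall a b, smooth_on U (fun x => complex.Re (F x a b)) /\
              smooth_on U (fun x => complex.Im (F x a b)).

Definition mx_derivable (R : realType) (V : normedModType R) (p q : nat)
    (F : V -> 'M[R[i]]_(p, q)) (x v : V) : Prop :=
  forall a b, derivable (fun y => complex.Re (F y a b)) x v /\
              derivable (fun y => complex.Im (F y a b)) x v.

Definition mx_derive (R : realType) (V : normedModType R) (p q : nat)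
    (F : V -> 'M[R[i]]_(p, q)) (x v : V) : 'M[R[i]]_(p, q) :=
  \matrix_(a, b) ('D_v (fun y => complex.Re (F y a b)) x +i*
                  'D_v (fun y => complex.Im (F y a b)) x).

(** Minkowski geometry *)

Definition minkowski (R : realType) (v w : spacetime R) : R :=
  - (v 0 0 * w 0 0) + \sum_(j < 4 | j != 0) v 0 j * w 0 j.

Definition lightlike (R : realType) (v : spacetime R) : Prop :=
  v <> 0 /\ minkowski v v = 0.

Definition future_causal (R : realType) (v : spacetime R) : Prop :=
  [/\ v <> 0, minkowski v v <= 0 & 0 < v 0 0].

Definition smooth_curve (R : realType) (g : R -> spacetime R) : Prop :=
  forall (k : nat) (s : R), derivable (derive1n k g) s 1.

(* A smooth curve on [s0, s1] is the restriction of one defined on R. *)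
Definition future_causal_curve (R : realType) (g : R -> spacetime R)
    (s0 s1 : R) : Prop :=
  smooth_curve g /\ forall s, s0 <= s <= s1 -> future_causal (derive1 g s).

Definition causal_le (R : realType) (x y : spacetime R) : Prop :=
  x = y \/ exists (g : R -> spacetime R) (s0 s1 : R),
    [/\ s0 < s1, future_causal_curve g s0 s1, g s0 = x & g s1 = y].

Definition causal_lt (R : realType) (x y : spacetime R) : Prop :=
  causal_le x y /\ x <> y.

Definition Jplus (R : realType) (x : spacetime R) : set (spacetime R) :=
  [set y | causal_le x y].

Definition Jminus (R : realType) (z : spacetime R) : set (spacetime R) :=
  [set y | causal_le y z].

(* (0, 1) x B(eps), with the Euclidean ball of R^3; the library norm on row
   vectors is the sup norm. *)
Definition mho (R : realType) (eps : R) : set (spacetime R) :=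
  [set x | 0 < x 0 0 < 1 /\
           Num.sqrt (\sum_(j < 4 | j != 0) x 0 j ^+ 2) < eps].

(* Open, since mho eps0 is open and causal_le is translation invariant. *)
Definition diamond (R : realType) (eps0 : R) : set (spacetime R) :=
  \bigcup_(x in mho eps0) \bigcup_(z in mho eps0) (Jplus x `&` Jminus z).

Definition lightlike_geodesic (R : realType) (g : R -> spacetime R) : Prop :=
  exists p v : spacetime R,
    lightlike v /\ forall s, g s = p + s *: v.

Definition light_related (R : realType) (x y : spacetime R) : Prop :=
  exists (g : R -> spacetime R) (s0 s1 : R),
    [/\ lightlike_geodesic g, g s0 = x & g s1 = y].

Definition broken_rays (R : realType) (eps : R) (x y z : spacetime R) : Prop :=
  [/\ light_related x y /\ light_related y z,
      causal_lt x y /\ causal_lt y z,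
      mho eps x /\ mho eps z
    & ~ mho eps y].

(** Connections and parallel transport *)

(* A j x is the component A_j at x of the 1-form \sum_j A_j dx^j. *)
Definition one_form (R : realType) (n : nat) : Type :=
  'I_4 -> spacetime R -> 'M[R[i]]_n.

Definition hermitian_connection (R : realType) (n : nat)
    (A : one_form R n) : Prop :=
  forall j : 'I_4,
    mx_smooth_on setT (A j) /\ forall x, (A j x)^t* = - A j x.

Definition pairing (R : realType) (n : nat) (A : one_form R n)
    (x v : spacetime R) : 'M[R[i]]_n :=
  \sum_(j < 4) (v 0 j)%:C *: A j x.

Definition parallel_along (R : realType) (n : nat) (A : one_form R n)
    (g : R -> spacetime R) (s0 s1 : R) (w : R -> 'cV[R[i]]_n) : Prop :=
  forall s, Num.min s0 s1 <= s <= Num.max s0 s1 ->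
    mx_derivable w s 1 /\
    mx_derive w s 1 + pairing A (g s) (derive1 g s) *m w s = 0.

Definition transports_to (R : realType) (n : nat) (A : one_form R n)
    (x y : spacetime R) (v v' : 'cV[R[i]]_n) : Prop :=
  exists (g : R -> spacetime R) (s0 s1 : R) (w : R -> 'cV[R[i]]_n),
    [/\ lightlike_geodesic g, g s0 = x /\ g s1 = y,
        parallel_along A g s0 s1 w, w s0 = v & w s1 = v'].

(* P^A_{y <- x}.  For smooth A and light-related x, y the transported vector
   exists and is unique, by the theory of linear ODEs; the default value 0 is
   only used when x and y are not light-related. *)
Definition ptransport (R : realType) (n : nat) (A : one_form R n)
    (y x : spacetime R) (v : 'cV[R[i]]_n) : 'cV[R[i]]_n :=
  xget 0 [set v' | transports_to A x y v v'].

(* S^A_{z <- y <- x} *)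
Definition broken_transform (R : realType) (n : nat) (A : one_form R n)
    (z y x : spacetime R) : 'cV[R[i]]_n -> 'cV[R[i]]_n :=
  ptransport A z y \o ptransport A y x.

(* Main.v *)
Require Import Defs.
From HB Require Import structures.
From mathcomp Require Import all_boot all_order all_algebra.
From mathcomp Require Import complex.
From mathcomp Require Import all_classical all_reals all_analysis.
From mathcomp Require Import ring lra.

Set Implicit Arguments.
Unset Strict Implicit.
Unset Printing Implicit Defensive.

Import Order.TTheory GRing.Theory Num.Theory.
Import numFieldNormedType.Exports.

Local Open Scope classical_set_scope.
Local Open Scope ring_scope.
Local Open Scope complex_scope.
Local Open Scope sesquilinear_scope.

(* On a point y of the cylinder off the axis, broken rays with both ends in a
   smaller cylinder not containing y may be shrunk to y; differentiating the
   equality of the transforms there gives A = B, first on null vectors and, as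
   these span, on all vectors.  Elsewhere the equality of the transforms says
   that u(y) = P^A_{y <- x} P^B_{x <- y} is the same for every past or future
   light-related x in the cylinder.  Moving y along the ray through x gives
   D_v u = u B(v) - A(v) u for an open set of null directions v.  Since u is
   unitary, these derivatives are bounded, so u is locally Lipschitz, hence
   continuous, hence strictly differentiable in the null directions and by
   linearity in all directions.  The equation du = u B - A u then makes u as
   smooth as A and B, without any smooth dependence of solutions of differential
   equations on parameters. *)

(** * Calculus on the real line *)

(** The hypothesis S^A = S^B separates variables. It can be rewritten as P^A_{y<-x} P^B_{x<-y} =
    P^A_{y<-z} P^B_{z<-y}, where the left side ignores z and the right side ignores x. Two past ends
    are therefore compared through a common future end, and for this the vertex has to see the
    cylinder in both time directions ([visible]). That condition is open in the vertex and in the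
    direction, so a null vector found at p0 still serves at every p near p0. The obstacle is that u
    is built from an unrelated choice at every point. A priori it is differentiable only along the
    null lines that come from the cylinder, and directional derivatives, even in a spanning set of
    directions, do not imply continuity. The argument thus has to start from a bound on u that
    presupposes no regularity; skew-Hermitian coefficients provide it through unitarity. For y
    inside the cylinder and off the axis, the radius |y| is the useful one: y lies just outside that
    open cylinder, while null segments that lean towards the axis enter it at once. *)

Section pointwise_rules.
Variables (R : realType) (V : normedModType R) (x v : V).
Implicit Types (f g : V -> R) (df dg k : R).

Lemma is_derive_add f g df dg : is_derive x v f df -> is_derive x v g dg ->
  is_derive x v (fun y => f y + g y) (df + dg).
Proof. by move=> *; exact: is_deriveD. Qed.

Lemma is_derive_sub f g df dg : is_derive x v f df -> is_derive x v g dg ->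
  is_derive x v (fun y => f y - g y) (df - dg).
Proof. by move=> *; exact: is_deriveB. Qed.

Lemma is_derive_opp f df :
  is_derive x v f df -> is_derive x v (fun y => - f y) (- df).
Proof. by move=> *; exact: is_deriveN. Qed.

Lemma is_derive_mul f g df dg : is_derive x v f df -> is_derive x v g dg ->
  is_derive x v (fun y => f y * g y) (df * g x + f x * dg).
Proof.
move=> hf hg; rewrite addrC [df * _]mulrC.
exact: (@is_deriveM R V f g x v df dg hf hg).
Qed.

Lemma is_derive_scale k f df :
  is_derive x v f df -> is_derive x v (fun y => k * f y) (k * df).
Proof. by move=> hf; exact: (@is_deriveZ R V _ f k x v df hf). Qed.

End pointwise_rules.

Lemma is_derive_bigsum (R : realType) (V : normedModType R) (I : Type)
    (r : seq I) (f : I -> V -> R) (df : I -> R) (x v : V) :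
  (forall i, is_derive x v (f i) (df i)) ->
  is_derive x v (fun y => \sum_(i <- r) f i y) (\sum_(i <- r) df i).
Proof.
move=> h; elim: r => [|i r IH].
  rewrite big_nil (_ : (fun _ => _) = cst 0); first exact: is_derive_cst.
  by apply/funext => y; rewrite big_nil.
rewrite big_cons.
rewrite (_ : (fun _ => _) = f i + (fun y => \sum_(i <- r) f i y)).
  exact: is_deriveD.
by apply/funext => y; rewrite big_cons.
Qed.

Lemma continuous_bigsum (R : realType) (T : topologicalType) (I : Type)
    (r : seq I) (f : I -> T -> R) (x : T) :
  (forall i, {for x, continuous (f i)}) ->
  {for x, continuous (fun y => \sum_(i <- r) f i y)}.
Proof.
move=> h; elim: r => [|i r IH].
  rewrite (_ : (fun _ => _) = cst 0); first exact: cst_continuous.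
  by apply/funext => y; rewrite big_nil.
rewrite (_ : (fun _ => _) = (fun y => f i y + \sum_(i <- r) f i y)).
  by apply: continuousD => //; exact: h.
by apply/funext => y; rewrite big_cons.
Qed.

Lemma is_derive_continuous (R : realType) (f : R -> R) (x df : R) :
  is_derive x 1 f df -> {for x, continuous f}.
Proof.
by move=> ?; apply/differentiable_continuous/derivable1_diffP.
Qed.

Section real_line.
Variable R : realType.
Implicit Types (f g F G : R -> R) (a b s x : R).

(** The mean value theorem for [G - F] and for [G + F]. Writing the bound as the derivative of a
    second function lets this lemma stand in for integral estimates: [G] is exponential in the
    Picard bounds and linear in the Lipschitz bounds. *)
Lemma le_increment F G f g a b : a <= b ->
  (forall x, x \in `[a, b] -> {for x, continuous F}) ->
  (forall x, x \in `[a, b] -> {for x, continuous G}) ->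
  (forall x, x \in `]a, b[ -> is_derive x 1 F (f x)) ->
  (forall x, x \in `]a, b[ -> is_derive x 1 G (g x)) ->
  (forall x, x \in `[a, b] -> `|f x| <= g x) ->
  `|F b - F a| <= G b - G a.
Proof.
move=> ab cF cG dF dG fg.
have wc (H : R -> R) : (forall x, x \in `[a, b] -> {for x, continuous H}) ->
    {within `[a, b], continuous H}.
  by move=> cH; apply: continuous_in_subspaceT => x; rewrite inE/=; exact: cH.
have [c1 c1ab] : exists2 c, c \in `[a, b]%R &
    (G - F) b - (G - F) a = (g c - f c) * (b - a).
  apply: (@MVT_segment _ _ (fun c => g c - f c)) => //.
    by move=> x xab; apply: is_deriveB; [exact: dG|exact: dF].
  by apply: wc => x xab; apply: continuousB; [exact: cG|exact: cF].
have [c2 c2ab] : exists2 c, c \in `[a, b]%R &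
    (G + F) b - (G + F) a = (g c + f c) * (b - a).
  apply: (@MVT_segment _ _ (fun c => g c + f c)) => //.
    by move=> x xab; apply: is_deriveD; [exact: dG|exact: dF].
  by apply: wc => x xab; apply: continuousD; [exact: cG|exact: cF].
rewrite !fctE => e2 e1.
have := fg _ c2ab; rewrite ler_norml => /andP[l2 _].
have := fg _ c1ab; rewrite ler_norml => /andP[_ l1].
have p1 : 0 <= (g c1 - f c1) * (b - a) by rewrite mulr_ge0// subr_ge0.
have p2 : 0 <= (g c2 + f c2) * (b - a).
  by rewrite mulr_ge0 ?subr_ge0//; lra.
by rewrite ler_norml; apply/andP; split; lra.
Qed.

Lemma derive0_cst_itv F a b : a <= b ->
  (forall x, a <= x <= b -> is_derive x 1 F 0) -> F b = F a.
Proof.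
move=> ab dF; apply/eqP; rewrite -subr_eq0 -normr_le0.
rewrite -[leRHS](subrr 0).
apply: (@le_increment F (cst 0) (cst 0) (cst 0)) => //.
- by move=> x; rewrite in_itv/= => /dF; exact: is_derive_continuous.
- by move=> x _; exact: cst_continuous.
- by move=> x; rewrite in_itv/= => /andP[/ltW ? /ltW ?]; apply: dF; apply/andP.
- by move=> x _; rewrite normr0.
Qed.

Lemma antiderivative f a b : a < b -> continuous f ->
  exists F, forall x, x \in `]a, b[ -> is_derive x 1 F (f x).
Proof.
move=> ab cf.
exists (fun x => \int[@lebesgue_measure R]_(t in `[a, x]) f t)%R => x.
rewrite in_itv/= => /andP[ax xb].
have fi : (@lebesgue_measure R).-integrable `[a, b] (EFin \o f).
  apply: continuous_compact_integrable; first exact: segment_compact.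
  exact: continuous_subspaceT.
have [] := @continuous_FTC1_closed R f a x b xb fi ax (cf x).
move=> d e; apply: DeriveDef; first exact: d.
by rewrite -derive1E.
Qed.

(** For [0 <= T], the retraction of the line onto [0, T]. Composition with it keeps functions
    controlled only on [0, T] continuous on all of R, as [antiderivative] demands. *)
Definition clamp (T s : R) : R := Num.min (Num.max s 0) T.

Lemma clamp_itv T s : 0 <= T -> 0 <= clamp T s <= T.
Proof.
by move=> T0; rewrite /clamp le_min T0 le_max lexx orbT/= ge_min lexx orbT.
Qed.

Lemma clamp_id T s : 0 <= s <= T -> clamp T s = s.
Proof.
by move=> /andP[s0 sT]; rewrite /clamp max_l// min_l.
Qed.

Lemma clamp_continuous T : continuous (clamp T).
Proof.
move=> s; rewrite /clamp.
apply: (@continuous_min _ _ (fun s => Num.max s 0) (cst T)).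
  apply: (@continuous_max _ _ id (cst 0)); first exact: cvg_id.
  exact: cst_continuous.
exact: cst_continuous.
Qed.

(* [S n - 2 C / 2 ^ n] increases and [S n + 2 C / 2 ^ n] decreases. *)
Lemma geometric_limit (S : nat -> R) (C : R) : 0 <= C ->
  (forall n, `|S n.+1 - S n| <= C * 2^-1 ^+ n) ->
  exists l, forall n, `|l - S n| <= 2 * C * 2^-1 ^+ n.
Proof.
move=> C0 SC.
pose lo n := S n - 2 * C * 2^-1 ^+ n; pose hi n := S n + 2 * C * 2^-1 ^+ n.
have half n : 2 * C * 2^-1 ^+ n.+1 = C * 2^-1 ^+ n by rewrite exprS; field.
have loS n : lo n <= lo n.+1.
  have := SC n; rewrite ler_norml /lo half -mulrA => /andP[+ _].
  by set z := C * _ => h; lra.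
have hiS n : hi n.+1 <= hi n.
  have := SC n; rewrite ler_norml /hi half -mulrA => /andP[_ +].
  by set z := C * _ => h; lra.
have lohi n : lo n <= hi n.
  by rewrite /lo /hi lerD2l ge0_cp// !mulr_ge0// exprn_ge0.
have lo_hi n p : lo n <= hi p.
  have lo_homo : {homo lo : a b / (a <= b)%N >-> a <= b}.
    by apply: homo_leq => //; exact: le_trans.
  have hi_homo : {homo hi : a b / (a <= b)%N >-> b <= a}.
    by apply: homo_leq => // a b c' h1 h2; exact: le_trans h2 h1.
  apply: (le_trans (lo_homo _ _ (leq_maxl n p))).
  exact: (le_trans (lohi _) (hi_homo _ _ (leq_maxr n p))).
have hs : has_sup (range lo).
  split; first by exists (lo 0%N), 0%N.
  by exists (hi 0%N) => _ [n _ <-].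
exists (sup (range lo)) => n.
have h1 : lo n <= sup (range lo) by apply: sup_upper_bound => //; exists n.
have h2 : sup (range lo) <= hi n.
  by apply: ge_sup; [case: hs|move=> _ [p _ <-]].
by move: h1 h2; rewrite /lo /hi ler_norml => h1 h2; apply/andP; split; lra.
Qed.

Lemma geometric_le0 (a b : R) :
  (forall n, a <= b * 2^-1 ^+ n) -> a <= 0.
Proof.
move=> h.
have c0 : geometric b (2^-1 : R) @ \oo --> 0.
  by apply: cvg_geometric; rewrite ger0_norm// invf_lt1// ltr1n.
have <- := cvg_lim (@Rhausdorff R) c0.
by apply: limr_ge; [exact: cvgP c0|exact: nearW].
Qed.

End real_line.

(** * Linear ordinary differential equations *)

Section linear_ode.
Variables (R : realType) (I : finType) (m : I -> I -> R -> R) (c : I -> R).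
Variable T : R.
Hypotheses (T0 : 0 < T) (cm : forall i j, continuous (m i j)).

Lemma coefficient_bound : exists2 K, 0 <= K &
  forall i s, 0 <= s <= T -> \sum_j `|m i j s| <= K.
Proof.
pose f (s : R) := \sum_(i : I) \sum_(j : I) `|m i j s|.
have cf : continuous f.
  move=> s; apply: continuous_bigsum => i; apply: continuous_bigsum => j.
  by apply: continuous_comp; [exact: cm|exact: norm_continuous].
have [x _ fx] := EVT_max (ltW T0) (continuous_subspaceT cf).
have ff (s : R) i : \sum_j `|m i j s| <= f s.
  rewrite /f [leRHS](bigD1 i)//= lerDl; apply: sumr_ge0 => j _.
  exact: sumr_ge0.
exists (f x); first by apply: sumr_ge0 => i _; exact: sumr_ge0.
by move=> i s s0T; apply: (le_trans (ff s i)); apply: fx; rewrite in_itv.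
Qed.

Definition continuous_family (w : I -> R -> R) := forall i, continuous (w i).

(** The integral of m w from 0. Continuity of [w] is assumed inside the existential so that [choice]
    produces a total operator on families, which [iter] can then iterate. *)
Lemma picard_step (w : I -> R -> R) : exists w' : I -> R -> R,
  continuous_family w ->
  [/\ continuous_family w', forall i, w' i 0 = 0 &
    forall i s, s \in `]0, T[ -> is_derive s 1 (w' i) (\sum_j m i j s * w j s)].
Proof.
have [cw|ncw] := pselect (continuous_family w); last by exists w.
have /choice[F HF] : forall i, exists F : R -> R,
    forall s, s \in `](-1), (T + 1)[ -> is_derive s 1 F (\sum_j m i j s * w j s).
  move=> i; apply: (@antiderivative R (fun s => \sum_j m i j s * w j s)).
    by move: T0; lra.
  move=> s; apply: continuous_bigsum => j.
  by apply: continuousM; [exact: cm|exact: cw].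
have HT (x : R) : 0 <= x <= T -> x \in `](-1), (T + 1)[.
  by rewrite in_itv/= => /andP[? ?]; apply/andP; split; lra.
exists (fun i s => F i (clamp T s) - F i 0) => _; split.
- move=> i s; apply: continuousB; last exact: cst_continuous.
  apply: continuous_comp; first exact: clamp_continuous.
  apply: is_derive_continuous; apply: HF; apply: HT.
  exact: clamp_itv (ltW T0).
- by move=> i; rewrite clamp_id ?subrr// lexx ltW.
- move=> i s sT.
  have sT' : s \in `](-1), (T + 1)[.
    by apply: HT; move: sT; rewrite in_itv/= => /andP[/ltW -> /ltW ->].
  have dF : is_derive s 1 (fun s => F i s - F i 0) (\sum_j m i j s * w j s).
    rewrite -[X in is_derive _ _ _ X]subr0.
    by apply: is_deriveB; exact: HF.
  apply: near_eq_is_derive dF => //.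
  near=> y; rewrite clamp_id//.
  have : y \in `]0, T[ by near: y; exact: near_in_itvoo.
  by rewrite in_itv/= => /andP[/ltW -> /ltW ->].
Unshelve. all: by end_near. Qed.



Lemma expR2_is_derive (C K s : R) :
  is_derive s 1 (fun s => C * expR (2 * K * s)) (C * (2 * K) * expR (2 * K * s)).
Proof.
have d1 : is_derive s 1 (fun s : R => 2 * K * s) (2 * K).
  by rewrite -[X in is_derive _ _ _ X]mulr1; exact: is_derive_scale.
rewrite (_ : C * _ * _ = C * (expR (2 * K * s) * (2 * K))); last by ring.
exact: is_derive_scale.
Qed.

(* The weight [expR (2 * K * s)] makes the Picard map a contraction of ratio
   1/2 on all of [0, T] at once. *)
Lemma picard_series : exists (d : nat -> I -> R -> R) (K C : R),
  [/\ 0 <= C, 0 <= K, forall k, continuous_family (d k), d 0%N = fun i =>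
    cst (c i) &
  [/\ forall k i, d k.+1 i 0 = 0, 
   forall k i s, s \in `]0, T[ ->
     is_derive s 1 (d k.+1 i) (\sum_j m i j s * d k j s),
   forall i s, 0 <= s <= T -> \sum_j `|m i j s| <= K &
   forall k i s, 0 <= s <= T -> `|d k i s| <= C * (2^-1) ^+ k]].
Proof.
have [K K0 HK] := coefficient_bound.
have [step Hstep] := choice picard_step.
pose d k := iter k step (fun i => cst (c i)).
have cd k : continuous_family (d k).
  elim: k => [i|k IH]; first exact: cst_continuous.
  by have [] := Hstep _ IH.
have dd k i s : s \in `]0, T[ ->
    is_derive s 1 (d k.+1 i) (\sum_j m i j s * d k j s).
  by have [_ _] := Hstep _ (cd k); exact.
have d0 k i : d k.+1 i 0 = 0 by have [_ + _] := Hstep _ (cd k); exact.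
pose C := \sum_i `|c i|.
have C0 : 0 <= C by apply: sumr_ge0.
have bd k i s : 0 <= s <= T -> `|d k i s| <= C * (2^-1) ^+ k * expR (2 * K * s).
  elim: k i s => [|k IH] i s /andP[s0 sT].
    rewrite expr0 mulr1 /d/=; apply: (@le_trans _ _ C).
      by rewrite /C (bigD1 i)//= lerDl sumr_ge0.
    by rewrite ler_peMr// -expR0 ler_expR !mulr_ge0.
  rewrite -[d k.+1 i s]subr0 -(d0 k i).
  apply: (@le_trans _ _ (C * 2^-1 ^+ k.+1 * expR (2 * K * s)
                        - C * 2^-1 ^+ k.+1 * expR (2 * K * 0))); last first.
    by rewrite lerBlDr lerDl !mulr_ge0// ?expR_ge0// exprn_ge0.
  apply: (@le_increment _ _ (fun s => C * 2^-1 ^+ k.+1 * expR (2 * K * s))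
    (fun s => \sum_j m i j s * d k j s)
    (fun s => C * 2^-1 ^+ k.+1 * (2 * K) * expR (2 * K * s))) => //.
  - by move=> x _; exact: cd.
  - by move=> x _; apply: is_derive_continuous; exact: expR2_is_derive.
  - move=> x; rewrite in_itv/= => /andP[x0 xs]; apply: dd.
    by rewrite in_itv/= x0 (lt_le_trans xs).
  - by move=> x _; exact: expR2_is_derive.
  - move=> x; rewrite in_itv/= => /andP[x0 xs].
    have xT : 0 <= x <= T by rewrite x0 (le_trans xs).
    apply: (le_trans (ler_norm_sum _ _ _)).
    apply: (@le_trans _ _ (\sum_j `|m i j x| * (C * 2^-1 ^+ k * expR (2 * K *
      x)))).
      by apply: ler_sum => j _; rewrite normrM ler_wpM2l// IH.
    rewrite -mulr_suml.
    have -> : C * 2^-1 ^+ k.+1 * (2 * K) * expR (2 * K * x) =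
      K * (C * 2^-1 ^+ k * expR (2 * K * x)) by rewrite exprS; field.
    rewrite ler_wpM2r ?HK// !mulr_ge0// ?expR_ge0// exprn_ge0//.
(* On [0, T] the exponential weight is at most its value at T. *)
exists d, K, (C * expR (2 * K * T)); split => //.
  by rewrite mulr_ge0// expR_ge0.
split => // k i s sT; apply: (le_trans (bd k i s sT)).
rewrite mulrAC ler_wpM2r ?exprn_ge0// ler_wpM2l// ler_expR.
by move: sT => /andP[? ?]; rewrite ler_wpM2l// mulr_ge0.
Qed.

(** The Picard sums [S n] converge uniformly on [0, T] to [f0]. Instead of differentiating this
    limit, [h] is defined as c plus the integral of m f0, and [h = f0] on [0, T] follows by
    comparing both with [S n.+1], whose derivative is m times [S n]. Integrating over (-1, T + 1)
    makes the derivatives of [h] two-sided at 0 and at T. *)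
Lemma linear_ode_solution : exists h : I -> R -> R,
  (forall i, h i 0 = c i) /\
  forall i s, 0 <= s <= T -> is_derive s 1 (h i) (\sum_j m i j s * h j s).
Proof.
have [d [K [C [C0 K0 cd d0 [dS dd HK bd]]]]] := picard_series.
pose S n i s := \sum_(k < n) d k i s.
have SS n i s : S n.+1 i s = S n i s + d n i s by rewrite /S big_ord_recr.
have S0 n i : S n.+1 i 0 = c i.
  by rewrite /S big_ord_recl/= d0/= big1 ?addr0//.
have cS n i : continuous (S n i) by move=> s; apply: continuous_bigsum => k;
  exact: cd.
have cT s : 0 <= clamp T s <= T by apply: clamp_itv; exact: ltW.
have /choice[f0 Hf0] : forall i, exists f0 : R -> R,
    forall s n, `|f0 s - S n i (clamp T s)| <= 2 * C * 2^-1 ^+ n.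
  move=> i; have /choice[f0 ?] : forall s, exists l,
      forall n, `|l - S n i (clamp T s)| <= 2 * C * 2^-1 ^+ n; last by exists f0.
  move=> s; apply: geometric_limit => // n.
  by rewrite SS addrAC subrr add0r bd.
have cf i : continuous (f0 i).
  move=> s; apply/cvgrPdist_le => /= e e0.
  have [n hn] : exists n, 2 * C * 2^-1 ^+ n <= e / 3.
    apply: contrapT => /forallNP h.
    suff : e / 3 <= 0 by lra.
    apply: (@geometric_le0 _ _ (2 * C)) => n.
    by have /negP := h n; rewrite -ltNge => /ltW.
  have cSc : {for s, continuous (S n i \o clamp T)}.
    by apply: continuous_comp; [exact: clamp_continuous|exact: cS].
  have e30 : 0 < e / 3 by rewrite divr_gt0.
  move/cvgrPdist_le : cSc => /(_ _ e30).
  apply: filterS => t /= ht.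
  have h1 := le_trans (Hf0 i s n) hn; have h2 := le_trans (Hf0 i t n) hn.
  move: ht h1 h2; rewrite !ler_norml => /andP[? ?] /andP[? ?] /andP[? ?].
  by apply/andP; split; lra.
have /choice[G HG] : forall i, exists G : R -> R,
    forall s, s \in `](-1), (T + 1)[ -> is_derive s 1 G (\sum_j m i j s * f0 j s).
  move=> i; apply: (@antiderivative R (fun s => \sum_j m i j s * f0 j s)).
    by move: T0; lra.
  move=> s; apply: continuous_bigsum => j.
  by apply: continuousM; [exact: cm|exact: cf].
have sub (x : R) : 0 <= x <= T -> x \in `](-1), (T + 1)[.
  by rewrite in_itv/= => /andP[? ?]; apply/andP; split; lra.
pose h i s := c i + (G i s - G i 0).
have dh i s : 0 <= s <= T -> is_derive s 1 (h i) (\sum_j m i j s * f0 j s).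
  move=> /sub sT; rewrite -[X in is_derive _ _ _ X]add0r.
  apply: is_derive_add.
  rewrite -[X in is_derive _ _ _ X]subr0.
  by apply: is_derive_sub; exact: HG.
have hf i s : 0 <= s <= T -> h i s = f0 i s.
  move=> sT; apply/eqP; rewrite -subr_eq0 -normr_le0.
  (* The first term integrates [K * (2 * C * 2^-1 ^+ n)], the bound on the derivative of
     [h i - S n.+1 i], over at most length T; the second is the distance from [f0 i] to
     [S n.+1 i]. *)
  apply: (@geometric_le0 _ _ (K * (2 * C) * T + C)) => n.
  have -> : h i s - f0 i s = (h i s - S n.+1 i s) - (f0 i s - S n.+1 i s) by ring.
  apply: (le_trans (ler_normB _ _)).
  have := Hf0 i s n.+1; rewrite clamp_id//.
  have -> : 2 * C * 2^-1 ^+ n.+1 = C * 2^-1 ^+ n by rewrite exprS; field.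
  move=> h2; rewrite mulrDl; apply: lerD h2.
  have s0 : 0 <= s by case/andP: sT.
  have sT' : s <= T by case/andP: sT.
  apply: (@le_trans _ _ (K * (2 * C * 2^-1 ^+ n) * s - K * (2 * C * 2^-1 ^+ n)
    * 0)); last first.
    rewrite mulr0 subr0 (_ : K * (2 * C) * T * _ = K * (2 * C * 2^-1 ^+ n) *
      T); last by ring.
    by rewrite ler_wpM2l// !mulr_ge0// exprn_ge0.
  pose F s := h i s - S n.+1 i s.
  pose G0 s := K * (2 * C * 2^-1 ^+ n) * s.
  have F0 : F 0 = 0 by rewrite /F S0 /h subrr addr0 subrr.
  suff : `|F s - F 0| <= G0 s - G0 0 by rewrite F0 subr0.
  have in0T (x : R) : x \in `[0, s] -> 0 <= x <= T.
    by rewrite in_itv/= => /andP[x0 xs]; rewrite x0 (le_trans xs).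
  have cF (x : R) : x \in `[0, s] -> {for x, continuous F}.
    move=> /in0T xT; apply: continuousB; last exact: cS.
    exact: is_derive_continuous (dh i x xT).
  have cG (x : R) : x \in `[0, s] -> {for x, continuous G0}.
    by move=> _; exact: mulrl_continuous.
  have dF (x : R) : x \in `]0, s[ ->
      is_derive x 1 F (\sum_j m i j x * f0 j x - \sum_j m i j x * S n j x).
    rewrite in_itv/= => /andP[x0 xs].
    have xT : x < T by exact: lt_le_trans xs _.
    have d1 : is_derive x 1 (h i) (\sum_j m i j x * f0 j x).
      by apply: dh; rewrite !ltW.
    have d2 : is_derive x 1 (S n.+1 i) (\sum_j m i j x * S n j x).
      rewrite (_ : \sum_j _ = 0 + \sum_(k < n) \sum_j m i j x * d k j x);
        last first.
        by rewrite add0r exchange_big; apply: eq_bigr => j _;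
          rewrite /S mulr_sumr.
      rewrite (_ : S n.+1 i = fun s => cst (c i) s + \sum_(k < n) d k.+1 i s);
        last first.
        by apply/funext => y; rewrite /S big_ord_recl d0.
      have d3 : is_derive x 1 (fun s => \sum_(k < n) d k.+1 i s)
          (\sum_(k < n) \sum_j m i j x * d k j x).
        by apply: is_derive_bigsum => k; apply: dd; rewrite in_itv/= x0.
      exact: is_derive_add (is_derive_cst (c i) x 1) d3.
    exact: is_derive_sub d1 d2.
  have dG (x : R) : x \in `]0, s[ -> is_derive x 1 G0 (K * (2 * C * 2^-1 ^+ n)).
    move=> _; rewrite -[X in is_derive _ _ _ X]mulr1.
    exact: is_derive_scale (is_derive_id x 1).
  have FG (x : R) : x \in `[0, s] ->
      `|\sum_j m i j x * f0 j x - \sum_j m i j x * S n j x| <=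
      K * (2 * C * 2^-1 ^+ n).
    move=> /in0T xT.
    rewrite -sumrB; apply: (le_trans (ler_norm_sum _ _ _)).
    apply: (@le_trans _ _ (\sum_j `|m i j x| * (2 * C * 2^-1 ^+ n))).
      apply: ler_sum => j _; rewrite -mulrBr normrM ler_wpM2l//.
      by have := Hf0 j x n; rewrite clamp_id.
    by rewrite -mulr_suml ler_wpM2r ?HK// !mulr_ge0// exprn_ge0.
  exact: le_increment s0 cF cG dF dG FG.
exists h; split; first by move=> i; rewrite /h subrr addr0.
move=> i s sT; rewrite (eq_bigr (fun j => m i j s * f0 j s)); first exact: dh.
by move=> j _; rewrite hf.
Qed.

End linear_ode.

(** * Calculus of complex matrices *)

Section complex_parts.
Variable R : rcfType.
Implicit Types z w : R[i].

Lemma complex_eqP z w :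
  complex.Re z = complex.Re w -> complex.Im z = complex.Im w -> z = w.
Proof. by case: z w => a b [c d] /= -> ->. Qed.

Lemma Re_add z w : complex.Re (z + w) = complex.Re z + complex.Re w.
Proof. by case: z w => a b [c d]. Qed.
Lemma Im_add z w : complex.Im (z + w) = complex.Im z + complex.Im w.
Proof. by case: z w => a b [c d]. Qed.
Lemma Re_opp z : complex.Re (- z) = - complex.Re z.
Proof. by case: z. Qed.
Lemma Im_opp z : complex.Im (- z) = - complex.Im z.
Proof. by case: z. Qed.
Lemma Re_mul z w : complex.Re (z * w) =
  complex.Re z * complex.Re w - complex.Im z * complex.Im w.
Proof. by case: z w => a b [c d]. Qed.
Lemma Im_mul z w : complex.Im (z * w) =
  complex.Re z * complex.Im w + complex.Im z * complex.Re w.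
Proof. by case: z w => a b [c d]. Qed.
Lemma Re_conjc z : complex.Re (Num.conj z) = complex.Re z.
Proof. by case: z. Qed.
Lemma Im_conjc z : complex.Im (Num.conj z) = - complex.Im z.
Proof. by case: z. Qed.
Lemma Re_sum (I : Type) (r : seq I) (f : I -> R[i]) :
  complex.Re (\sum_(i <- r) f i) = \sum_(i <- r) complex.Re (f i).
Proof. by apply: big_morph => //; exact: Re_add. Qed.
Lemma Im_sum (I : Type) (r : seq I) (f : I -> R[i]) :
  complex.Im (\sum_(i <- r) f i) = \sum_(i <- r) complex.Im (f i).
Proof. by apply: big_morph => //; exact: Im_add. Qed.

End complex_parts.

Definition complex_is_derive (R : realType) (V : normedModType R)
    (x v : V) (f : V -> R[i]) (d : R[i]) : Prop :=
  is_derive x v (fun y => complex.Re (f y)) (complex.Re d) /\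
  is_derive x v (fun y => complex.Im (f y)) (complex.Im d).

Definition mx_is_derive (R : realType) (V : normedModType R) (p q : nat)
    (x v : V) (F : V -> 'M[R[i]]_(p, q)) (D : 'M[R[i]]_(p, q)) : Prop :=
  forall a b, complex_is_derive x v (fun y => F y a b) (D a b).

Section complex_derive.
Variables (R : realType) (V : normedModType R) (x v : V).
Implicit Types (f g : V -> R[i]) (d e : R[i]).

Lemma complex_is_derive_mul f g d e :
  complex_is_derive x v f d -> complex_is_derive x v g e ->
  complex_is_derive x v (fun y => f y * g y) (d * g x + f x * e).
Proof.
move=> [fr fi] [gr gi]; split.
  rewrite (_ : (fun _ => _) = fun y =>
    complex.Re (f y) * complex.Re (g y) - complex.Im (f y) * complex.Im (g y));
      last first.
    by apply/funext => y; rewrite Re_mul.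
  rewrite (_ : complex.Re _ =
      (complex.Re d * complex.Re (g x) + complex.Re (f x) * complex.Re e) -
      (complex.Im d * complex.Im (g x) + complex.Im (f x) * complex.Im e));
        last first.
    by rewrite Re_add !Re_mul; ring.
  by apply: is_derive_sub; exact: is_derive_mul.
rewrite (_ : (fun _ => _) = fun y =>
  complex.Re (f y) * complex.Im (g y) + complex.Im (f y) * complex.Re (g y));
    last first.
  by apply/funext => y; rewrite Im_mul.
rewrite (_ : complex.Im _ =
    (complex.Re d * complex.Im (g x) + complex.Re (f x) * complex.Im e) +
    (complex.Im d * complex.Re (g x) + complex.Im (f x) * complex.Re e));
      last first.
  by rewrite Im_add !Im_mul; ring.
by apply: is_derive_add; exact: is_derive_mul.
Qed.

Lemma complex_is_derive_sum (I : Type) (r : seq I) (f : I -> V ->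
  R[i]) (d : I -> R[i]) :
  (forall i, complex_is_derive x v (f i) (d i)) ->
  complex_is_derive x v (fun y => \sum_(i <- r) f i y) (\sum_(i <- r) d i).
Proof.
move=> h; split.
  rewrite Re_sum (_ : (fun _ => _) = fun y => \sum_(i <- r) complex.Re (f i y)).
    by apply: is_derive_bigsum => i; exact: (h i).1.
  by apply/funext => y; rewrite Re_sum.
rewrite Im_sum (_ : (fun _ => _) = fun y => \sum_(i <- r) complex.Im (f i y)).
  by apply: is_derive_bigsum => i; exact: (h i).2.
by apply/funext => y; rewrite Im_sum.
Qed.

Lemma mx_is_derive_cst p q (A : 'M[R[i]]_(p, q)) : mx_is_derive x v (cst A) 0.
Proof. by move=> a b; rewrite mxE; split; exact: is_derive_cst. Qed.

Lemma mx_is_derive_mul p q r (F : V -> 'M[R[i]]_(p, q)) (G : V ->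
  'M[R[i]]_(q, r)) D E :
  mx_is_derive x v F D -> mx_is_derive x v G E ->
  mx_is_derive x v (fun y => F y *m G y) (D *m G x + F x *m E).
Proof.
move=> hF hG a b.
rewrite (_ : (fun _ => _) = fun y => \sum_j F y a j * G y j b); last first.
  by apply/funext => y; rewrite mxE.
rewrite !mxE -big_split/=; apply: complex_is_derive_sum => j.
exact: complex_is_derive_mul.
Qed.

Lemma mx_is_derive_adj p q (F : V -> 'M[R[i]]_(p, q)) D :
  mx_is_derive x v F D -> mx_is_derive x v (fun y => (F y)^t*) (D^t*).
Proof.
move=> hF a b; have [hr hi] := hF b a; split.
  rewrite !mxE Re_conjc (_ : (fun _ => _) = fun y => complex.Re (F y b a))//.
  by apply/funext => y; rewrite !mxE Re_conjc.
rewrite !mxE Im_conjc (_ : (fun _ => _) = fun y => - complex.Im (F y b a)).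
  exact: is_derive_opp.
by apply/funext => y; rewrite !mxE Im_conjc.
Qed.

Lemma mx_is_deriveP p q (F : V -> 'M[R[i]]_(p, q)) D :
  mx_is_derive x v F D <-> mx_derivable F x v /\ mx_derive F x v = D.
Proof.
split=> [hF|[dF <-] a b].
  split; first by move=> a b; have [[? ?] [? ?]] := hF a b.
  apply/matrixP => a b; rewrite mxE; have [hr hi] := hF a b.
  by apply: complex_eqP => /=; exact: derive_val.
by have [? ?] := dF a b; split; rewrite mxE/=; exact: derivableP.
Qed.

End complex_derive.

(** * Linear systems with skew-Hermitian coefficients *)

Section unitary_flow.
Variables (R : realType) (n : nat).

Lemma mx_derive0_cst p q (F : R -> 'M[R[i]]_(p, q)) (a b : R) : a <= b ->
  (forall s, a <= s <= b -> mx_is_derive s 1 F 0) -> F b = F a.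
Proof.
move=> ab dF; apply/matrixP => i j; apply: complex_eqP.
  apply: (@derive0_cst_itv _ (fun y => complex.Re (F y i j))) =>
    // s /dF /(_ i j) [+ _].
  by rewrite mxE.
apply: (@derive0_cst_itv _ (fun y => complex.Im (F y i j))) =>
  // s /dF /(_ i j) [_ +].
by rewrite mxE.
Qed.

Lemma adj_mul p q r (A : 'M[R[i]]_(p, q)) (B : 'M[R[i]]_(q, r)) :
  (A *m B)^t* = B^t* *m A^t*.
Proof. by rewrite trmx_mul map_mxM. Qed.

Lemma adj_opp p q (A : 'M[R[i]]_(p, q)) : (- A)^t* = - A^t*.
Proof. by apply/matrixP => i j; rewrite !mxE rmorphN. Qed.

(** The derivative of [(Y s)^t* *m X s] is the sum of [- Y^t* *m M^t* *m X] and [- Y^t* *m M *m X],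
    which cancel. Taking [X = Y] gives unitarity; taking for [Y] a fundamental solution gives
    uniqueness; taking fundamental solutions for A and for B shows that they coincide where A =
    B. *)
Lemma skew_flow_invariant p q (M : R -> 'M[R[i]]_n) (X : R -> 'M[R[i]]_(n, p))
    (Y : R -> 'M[R[i]]_(n, q)) (a b : R) : a <= b ->
  (forall s, a <= s <= b -> (M s)^t* = - M s) ->
  (forall s, a <= s <= b -> mx_is_derive s 1 X (- (M s *m X s))) ->
  (forall s, a <= s <= b -> mx_is_derive s 1 Y (- (M s *m Y s))) ->
  (Y b)^t* *m X b = (Y a)^t* *m X a.
Proof.
move=> ab skM dX dY.
apply: (@mx_derive0_cst _ _ (fun s => (Y s)^t* *m X s)) => // s sab.
have := mx_is_derive_mul (mx_is_derive_adj (dY s sab)) (dX s sab).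
suff -> : (- (M s *m Y s))^t* *m X s + (Y s)^t* *m - (M s *m X s) = 0 by [].
rewrite adj_opp adj_mul skM// mulmxN opprK mulmxN.
by rewrite -mulmxA subrr.
Qed.

Lemma flow_solution (T : R) (M : R -> 'M[R[i]]_n) : 0 < T ->
  (forall a b, continuous (fun s => complex.Re (M s a b)) /\
               continuous (fun s => complex.Im (M s a b))) ->
  exists Phi : R -> 'M[R[i]]_n, Phi 0 = 1%:M /\
    forall s, 0 <= s <= T -> mx_is_derive s 1 Phi (- (M s *m Phi s)).
Proof.
move=> T0 cM.
(* The real form of - M: [false] indexes real parts and [true] imaginary parts. *)
pose m (i j : bool * 'I_n) (s : R) : R :=
  match i.1, j.1 with
  | false, false | true, true => - complex.Re (M s i.2 j.2)
  | false, true => complex.Im (M s i.2 j.2)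
  | true, false => - complex.Im (M s i.2 j.2)
  end.
have cm i j : continuous (m i j).
  by case: i j => [[] i] [[] j] s; rewrite /m/=; try apply: continuousN;
    [exact: (cM i j).1|exact: (cM i j).2|exact: (cM i j).2|exact: (cM i j).1].
have /choice[h Hh] (b : 'I_n) := @linear_ode_solution R _ m
  (fun i => if i.1 then 0 else (i.2 == b)%:R) T T0 cm.
exists (fun s => \matrix_(a, b) (h b (false, a) s +i* h b (true, a) s)); split.
  apply/matrixP => a b; rewrite !mxE !(Hh b).1/=.
  by case: eqP.
have e (f : bool * 'I_n -> R) : \sum_i f i = \sum_a (f (false, a) + f (true, a)).
  rewrite (eq_bigr (fun i => f (i.1, i.2))); last by case.
  rewrite -(pair_bigA _ (fun b a => f (b, a)))/=.
  by rewrite big_bool/= -big_split; apply: eq_bigr => a _; rewrite addrC.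
move=> s sT a b; split.
  rewrite (_ : (fun _ => _) = h b (false, a)); last by apply/funext => y;
    rewrite !mxE.
  have := (Hh b).2 (false, a) s sT; rewrite e/= /m/=; set z1 := BIG_F.
  rewrite !mxE Re_opp Re_sum -sumrN; congr (is_derive _ _ _ _).
  by apply: eq_bigr => i _; rewrite /z1 !mxE Re_mul/=; ring.
rewrite (_ : (fun _ => _) = h b (true, a)); last by apply/funext => y;
  rewrite !mxE.
have := (Hh b).2 (true, a) s sT; rewrite e/= /m/=; set z1 := BIG_F.
rewrite !mxE Im_opp Im_sum -sumrN; congr (is_derive _ _ _ _).
by apply: eq_bigr => i _; rewrite /z1 !mxE Im_mul/=; ring.
Qed.

Lemma unitary_flow (T : R) (M : R -> 'M[R[i]]_n) : 0 < T ->
  (forall a b, continuous (fun s => complex.Re (M s a b)) /\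
               continuous (fun s => complex.Im (M s a b))) ->
  (forall s, (M s)^t* = - M s) ->
  exists Phi : R -> 'M[R[i]]_n, Phi 0 = 1%:M /\
    forall s, 0 <= s <= T -> mx_is_derive s 1 Phi (- (M s *m Phi s)) /\
      (Phi s)^t* *m Phi s = 1%:M.
Proof.
move=> T0 cM skM; have [Phi [Phi0 dPhi]] := flow_solution T0 cM.
exists Phi; split=> // s sT; split; first exact: dPhi.
have [s0 sT'] := andP sT.
have d r : 0 <= r <= s -> mx_is_derive r 1 Phi (- (M r *m Phi r)).
  by move=> /andP[r0 rs]; apply: dPhi; rewrite r0 (le_trans rs).
rewrite (@skew_flow_invariant n n M Phi Phi 0 s)//.
by rewrite Phi0 mulmx1 trmx1 map_mx1.
Qed.

End unitary_flow.

(** * Parallel transport along lines *)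

Section connection.
Variables (R : realType) (n : nat) (A : one_form R n).
Implicit Types (x y v w : spacetime R) (k : R).

Lemma pairing_entry x v a b :
  pairing A x v a b = \sum_(j < 4) (v 0 j)%:C * A j x a b.
Proof. by rewrite summxE; apply: eq_bigr => j _; rewrite mxE. Qed.

Lemma Re_pairing x v a b :
  complex.Re (pairing A x v a b) = \sum_(j < 4) v 0 j * complex.Re (A j x a b).
Proof.
rewrite pairing_entry Re_sum; apply: eq_bigr => j _.
by rewrite Re_mul/= mul0r subr0.
Qed.

Lemma Im_pairing x v a b :
  complex.Im (pairing A x v a b) = \sum_(j < 4) v 0 j * complex.Im (A j x a b).
Proof.
rewrite pairing_entry Im_sum; apply: eq_bigr => j _.
by rewrite Im_mul/= mul0r addr0.
Qed.

Lemma pairingD x v w : pairing A x (v + w) = pairing A x v + pairing A x w.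
Proof.
rewrite /pairing -big_split; apply: eq_bigr => j _.
by rewrite mxE rmorphD/= scalerDl.
Qed.

Lemma pairingZ x k v : pairing A x (k *: v) = k%:C *: pairing A x v.
Proof.
rewrite /pairing scaler_sumr; apply: eq_bigr => j _.
by rewrite mxE rmorphM/= scalerA.
Qed.

Lemma pairingN x v : pairing A x (- v) = - pairing A x v.
Proof.
rewrite /pairing -sumrN; apply: eq_bigr => j _.
by rewrite mxE rmorphN/= scaleNr.
Qed.

Lemma pairing_basis x j : pairing A x (basis_vec R j) = A j x.
Proof.
rewrite /pairing (bigD1 j)//= big1 ?addr0; last first.
  by move=> i ij; rewrite mxE (negbTE ij) andbF scale0r.
by rewrite mxE !eqxx/= scale1r.
Qed.

Hypothesis hA : hermitian_connection A.

Lemma pairing_skew x v : (pairing A x v)^t* = - pairing A x v.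
Proof.
apply/matrixP => a b; rewrite !mxE !pairing_entry rmorph_sum -sumrN.
apply: eq_bigr => j _; have /matrixP/(_ a b) := (hA j).2 x.
rewrite !mxE => h; rewrite rmorphM/= h -mulrN; congr (_ * _).
by apply: complex_eqP; rewrite /= ?oppr0.
Qed.

Lemma Re_connection_continuous j a b : continuous (fun x =>
  complex.Re (A j x a b)).
Proof. by move=> x; have [/(_ 0%N)[h _] _] := (hA j).1 a b; exact: h. Qed.

Lemma Im_connection_continuous j a b : continuous (fun x =>
  complex.Im (A j x a b)).
Proof. by move=> x; have [_ /(_ 0%N)[h _]] := (hA j).1 a b; exact: h. Qed.

Lemma Re_pairing_continuous v a b :
  continuous (fun x => complex.Re (pairing A x v a b)).
Proof.
rewrite (_ : (fun _ => _) = fun x => \sum_(j < 4) v 0 j * complex.Re (A j x a b)).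
  move=> x; apply: continuous_bigsum => j; apply: continuousM.
    exact: cst_continuous.
  exact: Re_connection_continuous.
by apply/funext => x; rewrite Re_pairing.
Qed.

Lemma Im_pairing_continuous v a b :
  continuous (fun x => complex.Im (pairing A x v a b)).
Proof.
rewrite (_ : (fun _ => _) = fun x => \sum_(j < 4) v 0 j * complex.Im (A j x a b)).
  move=> x; apply: continuous_bigsum => j; apply: continuousM.
    exact: cst_continuous.
  exact: Im_connection_continuous.
by apply/funext => x; rewrite Im_pairing.
Qed.

End connection.

Lemma is_derive_line (R : realType) (V : normedModType R) (p v : V) (s : R) :
  is_derive s 1 (fun s : R => p + s *: v) v.
Proof.
have d : is_derive s 1 (fun s : R => s *: v) v.
  have h := is_diff_scalel s v; apply: DeriveDef.
    by apply/derivable1_diffP; exact: ex_diff.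
  by rewrite deriveE ?diff_val ?scale1r//; exact: ex_diff.
rewrite -[X in is_derive _ _ _ X]add0r.
exact: is_deriveD (is_derive_cst p s 1) d.
Qed.

Lemma line_continuous (R : realType) (V : normedModType R) (p v : V) :
  continuous (fun s : R => p + s *: v).
Proof.
move=> s; apply/differentiable_continuous/derivable1_diffP.
exact: (@ex_derive _ _ _ _ _ _ _ (is_derive_line p v s)).
Qed.

Lemma derive1_line (R : realType) (V : normedModType R) (p v : V) (s : R) :
  derive1 (fun s : R => p + s *: v) s = v.
Proof. by rewrite derive1E; apply: derive_val; exact: is_derive_line. Qed.

(* Parallel transport along the line [s |-> p + s *: v], 0 <= s <= 2; the
   extra length beyond 1 makes two-sided derivatives at s = 1 available. *)
Definition frame (R : realType) (n : nat) (A : one_form R n)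
    (p v : spacetime R) (Phi : R -> 'M[R[i]]_n) : Prop :=
  Phi 0 = 1%:M /\ forall s : R, 0 <= s <= 2 ->
    mx_is_derive s 1 Phi (- (pairing A (p + s *: v) v *m Phi s)) /\
    (Phi s)^t* *m Phi s = 1%:M.

Section transport.
Variables (R : realType) (n : nat) (A : one_form R n).
Hypothesis hA : hermitian_connection A.
Implicit Types p v : spacetime R.

Lemma frame_exists p v : exists Phi, frame A p v Phi.
Proof.
apply: (@unitary_flow R n 2 (fun s => pairing A (p + s *: v) v)) => //.
  move=> a b; split=> s.
    apply: (@continuous_comp _ _ _ (fun s : R => p + s *: v)
      (fun x => complex.Re (pairing A x v a b))); first exact: line_continuous.
    exact: Re_pairing_continuous.
  apply: (@continuous_comp _ _ _ (fun s : R => p + s *: v)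
    (fun x => complex.Im (pairing A x v a b))); first exact: line_continuous.
  exact: Im_pairing_continuous.
by move=> s; exact: pairing_skew.
Qed.

Lemma mx_is_derive_comp_affine m q (F : R -> 'M[R[i]]_(m, q)) (k c s : R) D :
  mx_is_derive (k * s + c) 1 F D ->
  mx_is_derive s 1 (fun s => F (k * s + c)) (k%:C *: D).
Proof.
have ds : is_derive s 1 (fun s : R => k * s + c) k.
  rewrite -[X in is_derive _ _ _ X]addr0 -[X in is_derive _ _ _ (X + _)]mulr1.
  exact: is_derive_add (is_derive_scale k (is_derive_id s 1)) (is_derive_cst c
    s 1).
move=> hF a b; have [hr hi] := hF a b; rewrite mxE; split.
  rewrite Re_mul/= mul0r subr0 mulrC.
  exact: (@is_derive1_comp _ (fun s => complex.Re (F s a b)) (fun s : R =>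
    k * s + c)).
rewrite Im_mul/= mul0r addr0 mulrC.
exact: (@is_derive1_comp _ (fun s => complex.Im (F s a b)) (fun s : R =>
  k * s + c)).
Qed.

Lemma frame_derive p v Phi (s : R) : frame A p v Phi -> 0 <= s <= 2 ->
  mx_is_derive s 1 Phi (- (pairing A (p + s *: v) v *m Phi s)).
Proof. by move=> [_ h] /h[]. Qed.

Lemma frame_adjK p v Phi (s : R) : frame A p v Phi -> 0 <= s <= 2 ->
  (Phi s)^t* *m Phi s = 1%:M.
Proof. by move=> [_ h] /h[]. Qed.

Lemma frame_Kadj p v Phi (s : R) : frame A p v Phi -> 0 <= s <= 2 ->
  Phi s *m (Phi s)^t* = 1%:M.
Proof. by move=> fP s02; apply: mulmx1C; exact: frame_adjK fP s02. Qed.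

Lemma itv02_between (s0 s1 t : R) : 0 <= s0 <= 2 -> 0 <= s1 <= 2 ->
  Num.min s0 s1 <= t <= Num.max s0 s1 -> 0 <= t <= 2.
Proof.
move=> /andP[a b] /andP[c d]; rewrite ge_min le_max.
by move=> /andP[/orP[]h1 /orP[]h2]; apply/andP; split; lra.
Qed.

Lemma transports_to_frame p v Phi (s0 s1 : R) w :
  frame A p v Phi -> lightlike v -> 0 <= s0 <= 2 -> 0 <= s1 <= 2 ->
  transports_to A (p + s0 *: v) (p + s1 *: v) w (Phi s1 *m ((Phi s0)^t* *m w)).
Proof.
move=> fP lv h0 h1.
exists (fun s => p + s *: v), s0, s1, (fun s => Phi s *m ((Phi s0)^t* *m w)).
split=> //; first by exists p, v.
- move=> s /(itv02_between h0 h1) s02; rewrite derive1_line.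
  have := mx_is_derive_mul (frame_derive fP s02)
            (mx_is_derive_cst s (1 : R) ((Phi s0)^t* *m w)).
  move/mx_is_deriveP => [d1 d2]; split; first exact: d1.
  by rewrite d2 /= mulmx0 addr0 mulNmx mulmxA addNr.
- by rewrite mulmxA (frame_Kadj fP h0) mul1mx.
Qed.

(** Two distinct points determine their line, so any competing geodesic is an affine
    reparametrization s -> k s + c of the given one. Then [Phi (k * s + c)] solves the same equation
    as the competing vector field, and [skew_flow_invariant] applies to the pair. *)
Lemma transports_to_unique p v Phi (s0 s1 : R) w w' :
  frame A p v Phi -> v <> 0 -> 0 <= s0 <= 2 -> 0 <= s1 <= 2 -> s0 != s1 ->
  transports_to A (p + s0 *: v) (p + s1 *: v) w w' ->
  w' = Phi s1 *m ((Phi s0)^t* *m w).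
Proof.
move=> fP v0 h0 h1 s01 [g [r0 [r1 [X [lg [g0 g1] pX Xr0 Xr1]]]]].
have [p' [v' [_ gE]]] := lg.
have gfun : g = fun s => p' + s *: v' by apply/funext.
have e0 : p' + r0 *: v' = p + s0 *: v by rewrite -gE.
have e1 : p' + r1 *: v' = p + s1 *: v by rewrite -gE.
have e : (r1 - r0) *: v' = (s1 - s0) *: v.
  rewrite !scalerBl.
  have -> : r1 *: v' - r0 *: v' = (p' + r1 *: v') - (p' + r0 *: v').
    by rewrite opprD addrACA subrr add0r.
  by rewrite e0 e1 opprD addrACA subrr add0r.
have r01 : r1 - r0 != 0.
  apply/eqP => z; move: e; rewrite z scale0r => /esym/eqP.
  by rewrite scaler_eq0 subr_eq0 eq_sym (negbTE s01)/= => /eqP.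
pose k := (s1 - s0) / (r1 - r0); pose c := s0 - k * r0.
have v'E : v' = k *: v.
  by rewrite /k mulrC -scalerA -e scalerA mulVf// scale1r.
have p'E : p' = p + c *: v.
  have -> : p' = (p + s0 *: v) - r0 *: v' by rewrite -e0 addrK.
  by rewrite v'E scalerA /c scalerBl addrA [r0 * k]mulrC.
have lineE s : p' + s *: v' = p + (k * s + c) *: v.
  by rewrite p'E v'E scalerA scalerDl addrA addrAC [s * k]mulrC -!addrA [_ *: v
    + _]addrC.
have k0 : k * r0 + c = s0 by rewrite /c; ring.
have k1 : k * r1 + c = s1 by rewrite /c /k; field.
have s02 s : Num.min r0 r1 <= s <= Num.max r0 r1 -> 0 <= k * s + c <= 2.
  have kE : k * (r1 - r0) = s1 - s0 by rewrite /k divfK.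
  move: h0 h1; rewrite -k0 -k1 => /andP[? ?] /andP[? ?].
  rewrite ge_min le_max => /andP[h2 h3]; have [rr|rr] := leP r0 r1.
    have {h2} h2 : r0 <= s by case/orP: h2 => // h2; lra.
    have {h3} h3 : s <= r1 by case/orP: h3 => // h3; lra.
    have [kk|kk] := leP 0 k; apply/andP; split; nra.
  have {h2} h2 : r1 <= s by case/orP: h2 => // h2; lra.
  have {h3} h3 : s <= r0 by case/orP: h3 => // h3; lra.
  have [kk|kk] := leP 0 k; apply/andP; split; nra.
(* The competing geodesic may run backwards ([r1 < r0]), hence [min] and [max]. *)
have inv : (Phi (k * Num.max r0 r1 + c))^t* *m X (Num.max r0 r1) =
           (Phi (k * Num.min r0 r1 + c))^t* *m X (Num.min r0 r1).
  apply: (@skew_flow_invariant R n _ _ (fun s => pairing A (p' + s *: v') v')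
    X (fun s => Phi (k * s + c))).
  - by rewrite ge_min le_max lexx.
  - by move=> s _; exact: pairing_skew.
  - move=> s /pX[d1]; rewrite gfun derive1_line => d2; apply/mx_is_deriveP;
    split => //.
    by apply/eqP; rewrite -addr_eq0 d2.
  - move=> s sr; have := mx_is_derive_comp_affine (frame_derive fP (s02 _ sr)).
    by rewrite -lineE v'E pairingZ scalerN scalemxAl.
have {}inv : (Phi s1)^t* *m w' = (Phi s0)^t* *m w.
  by move: inv; case: (leP r0 r1) => _; rewrite ?k0 ?k1 Xr0 Xr1 => ->.
by rewrite -inv mulmxA (frame_Kadj fP h1) mul1mx.
Qed.

(** Existence and uniqueness force the value selected by [xget]. From here on every transport is a
    product of frames and their adjoints. *)
Lemma ptransport_frame p v Phi (s0 s1 : R) w :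
  frame A p v Phi -> lightlike v -> 0 <= s0 <= 2 -> 0 <= s1 <= 2 -> s0 != s1 ->
  ptransport A (p + s1 *: v) (p + s0 *: v) w = Phi s1 *m (Phi s0)^t* *m w.
Proof.
move=> fP lv h0 h1 s01; rewrite -mulmxA; apply: xget_unique.
  exact: transports_to_frame.
by move=> w' /(transports_to_unique fP lv.1 h0 h1 s01).
Qed.

End transport.

(** * Minkowski geometry *)

Section space_part.
Variable R : realType.
Implicit Types (x y z v w a : spacetime R) (k t : R).

Definition sdot x y : R := \sum_(j < 4 | j != 0) x 0 j * y 0 j.

Definition snorm x : R := Num.sqrt (\sum_(j < 4 | j != 0) x 0 j ^+ 2).

(** Spatial vectors are represented by spacetime vectors whose time coordinate is disregarded, as
    [sdot] and [snorm] do. The two null vectors over [a] are then [at_time (snorm a) a] and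
    [at_time (- snorm a) a]. *)
Definition at_time t a : spacetime R := \row_j (if j == 0 then t else a 0 j).

Lemma sdotC x y : sdot x y = sdot y x.
Proof. by apply: eq_bigr => j _; rewrite mulrC. Qed.

Lemma sdotDl x y z : sdot (x + y) z = sdot x z + sdot y z.
Proof. by rewrite -big_split; apply: eq_bigr => j _; rewrite mxE mulrDl. Qed.

Lemma sdotZl k x z : sdot (k *: x) z = k * sdot x z.
Proof. by rewrite /sdot mulr_sumr; apply: eq_bigr => j _; rewrite mxE mulrA. Qed.

Lemma sdotDr x y z : sdot x (y + z) = sdot x y + sdot x z.
Proof. by rewrite sdotC sdotDl !(sdotC x). Qed.

Lemma sdotZr k x z : sdot x (k *: z) = k * sdot x z.
Proof. by rewrite sdotC sdotZl sdotC. Qed.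

Lemma sdotNr x y : sdot x (- y) = - sdot x y.
Proof. by rewrite -scaleN1r sdotZr mulN1r. Qed.

Lemma sdotNl x y : sdot (- x) y = - sdot x y.
Proof. by rewrite -scaleN1r sdotZl mulN1r. Qed.

Lemma sdot0l x : sdot 0 x = 0.
Proof. by rewrite -(scale0r 0) sdotZl mul0r. Qed.

Lemma snorm_ge0 x : 0 <= snorm x. Proof. exact: sqrtr_ge0. Qed.

Lemma sqr_snorm x : snorm x ^+ 2 = sdot x x.
Proof. by rewrite sqr_sqrtr ?sumr_ge0// => j _; exact: sqr_ge0. Qed.

Lemma snormE x : snorm x = Num.sqrt (sdot x x).
Proof. by []. Qed.

Lemma snormZ k x : snorm (k *: x) = `|k| * snorm x.
Proof.
by rewrite snormE sdotZl sdotZr mulrA -expr2 sqrtrM ?sqr_ge0// sqrtr_sqr.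
Qed.

Lemma snorm_eq0 x j : snorm x = 0 -> j != 0 -> x 0 j = 0.
Proof.
move=> x0 j0; have /eqP : sdot x x = 0 by rewrite -sqr_snorm x0 expr0n.
rewrite psumr_eq0; last by move=> i _; rewrite -expr2 sqr_ge0.
by move/allP/(_ j (mem_index_enum _)); rewrite j0/= mulf_eq0 orbb => /eqP.
Qed.

Lemma snormN x : snorm (- x) = snorm x.
Proof. by rewrite -scaleN1r snormZ normrN normr1 mul1r. Qed.

Lemma snorm0 : snorm 0 = 0.
Proof. by rewrite snormE sdot0l sqrtr0. Qed.

(** Cauchy-Schwarz, from the square of [snorm y *: x - snorm x *: y]; the division by the product of
    the norms leaves the degenerate cases to be treated apart. *)
Lemma sdot_le x y : sdot x y <= snorm x * snorm y.
Proof.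
have x0 := snorm_ge0 x; have y0 := snorm_ge0 y.
have : 0 <= sdot (snorm y *: x + (- snorm x) *: y) (snorm y *: x + (- snorm x)
  *: y).
  by apply: sumr_ge0 => j _; rewrite -expr2 sqr_ge0.
rewrite sdotDl !sdotDr !sdotZl !sdotZr -!sqr_snorm (sdotC y x).
have [x1|x1] := eqVneq (snorm x) 0.
  by rewrite x1 mul0r /sdot big1// => j /(snorm_eq0 x1) ->; rewrite mul0r.
have [y1|y1] := eqVneq (snorm y) 0.
  by rewrite y1 mulr0 /sdot big1// => j /(snorm_eq0 y1) ->; rewrite mulr0.
move=> h.
have xy : 0 < snorm x * snorm y by rewrite mulr_gt0 ?lt0r ?y1 ?x1.
rewrite -subr_ge0 -(pmulr_rge0 _ xy); nra.
Qed.

Lemma snorm_triangle x y : snorm (x + y) <= snorm x + snorm y.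
Proof.
rewrite -(@ler_pXn2r _ 2)// ?nnegrE ?addr_ge0 ?snorm_ge0//.
rewrite sqr_snorm sdotDl !sdotDr sqrrD -!sqr_snorm (sdotC y x).
have := sdot_le x y; lra.
Qed.

Lemma snorm_at_time t a : snorm (at_time t a) = snorm a.
Proof.
by rewrite /snorm; congr Num.sqrt; apply: eq_bigr => j j0;
  rewrite mxE (negbTE j0).
Qed.

Lemma at_time0 t a : at_time t a 0 0 = t.
Proof. by rewrite mxE. Qed.

Lemma at_timeS t a j : j != 0 -> at_time t a 0 j = a 0 j.
Proof. by rewrite mxE => /negbTE ->. Qed.

Lemma at_timeD t t' a b : at_time t a + at_time t' b = at_time (t + t') (a + b).
Proof. by apply/rowP => j; rewrite !mxE; case: eqP. Qed.

Lemma at_timeZ k t a : k *: at_time t a = at_time (k * t) (k *: a).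
Proof. by apply/rowP => j; rewrite !mxE; case: eqP. Qed.

Lemma at_time_id a : at_time (a 0 0) a = a.
Proof. by apply/rowP => j; rewrite !mxE; case: eqP => [->|]. Qed.

Lemma minkowski_snorm v : Defs.minkowski v v = snorm v ^+ 2 - v 0 0 ^+ 2.
Proof. by rewrite sqr_snorm /Defs.minkowski addrC expr2. Qed.

Lemma lightlike_snorm v : lightlike v -> snorm v = `|v 0 0| /\ snorm v != 0.
Proof.
move=> [v0 /eqP]; rewrite minkowski_snorm subr_eq0 => /eqP e.
have e' : snorm v = `|v 0 0|.
  by rewrite -sqrtr_sqr -e sqrtr_sqr ger0_norm ?snorm_ge0.
split=> //; apply/eqP => s0; apply: v0; apply/rowP => j; rewrite mxE.
have [->|j0] := eqVneq j 0.
  by apply/eqP; rewrite -normr_eq0 -e' s0.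
exact: snorm_eq0.
Qed.

Lemma lightlike_at_time t a : snorm a != 0 -> `|t| = snorm a ->
  lightlike (at_time t a).
Proof.
move=> a0 ta; split.
  move=> e; move: a0; rewrite -(snorm_at_time t a) e.
  by rewrite -(scale0r 0) snormZ normr0 mul0r eqxx.
by rewrite minkowski_snorm snorm_at_time at_time0 -ta real_normK ?num_real//
  subrr.
Qed.

Lemma lightlikeZ k v : k != 0 -> lightlike v -> lightlike (k *: v).
Proof.
move=> k0 [v0 e]; split.
  by move/eqP; rewrite scaler_eq0 (negbTE k0)/= => /eqP.
move: e; rewrite !minkowski_snorm snormZ mxE !exprMn real_normK ?num_real//.
by rewrite -mulrBr => ->; rewrite mulr0.
Qed.

Lemma snorm_continuous : continuous snorm.
Proof.
move=> x; apply: (@continuous_comp _ _ _ (fun x => sdot x x) Num.sqrt).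
  rewrite (_ : (fun _ => _) = fun x : spacetime R =>
      \sum_(j <- [seq j <- index_enum 'I_4 | j != 0]) x 0 j * x 0 j).
    apply: continuous_bigsum => j.
    by apply: continuousM; exact: coord_continuous.
  by apply/funext => y; rewrite big_filter.
exact: sqrt_continuous.
Qed.

Lemma at_time_continuous (T : topologicalType) (f : T -> R) (g : T ->
  spacetime R) (u : T) :
  {for u, continuous f} -> {for u, continuous g} ->
  {for u, continuous (fun u => at_time (f u) (g u))}.
Proof.
move=> cf cg.
rewrite (_ : (fun _ => _) = fun u =>
  g u + (f u - g u 0 0) *: (delta_mx 0 0 : spacetime R)).
  have cg0 : {for u, continuous (fun u => g u 0 0)}.
    exact: (@continuous_comp _ _ _ g (fun x : spacetime R => x 0 0) _ cg
             (@coord_continuous _ _ _ _ _ _)).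
  have cfg : {for u, continuous (fun u => f u - g u 0 0)}.
    exact: (@continuousB _ _ _ f (fun u => g u 0 0) _ cf cg0).
  have cz : {for u, continuous (fun u =>
    (f u - g u 0 0) *: (delta_mx 0 0 : spacetime R))}.
    exact: (@continuous_comp _ _ _ (fun u => f u - g u 0 0)
      (fun s : R => s *: (delta_mx 0 0 : spacetime R)) _ cfg
        (@scalel_continuous _ _ _ _)).
  exact: (@continuousD _ _ _ g _ _ cg cz).
apply/funext => z; apply/rowP => j; rewrite !mxE eqxx/=.
by case: eqP => [->|_]; rewrite ?mulr1 ?mulr0 ?addr0// addrC subrK.
Qed.

(* Sums of the two null vectors over a give all spatial vectors near a0, and
   their differences the time axis. *)
Lemma null_span (P : spacetime R -> Prop) a0 :
  (forall v w, P v -> P w -> P (v + w)) -> (forall k v, P v -> P (k *: v)) ->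
  snorm a0 != 0 ->
  (\forall a \near a0, P (at_time (snorm a) a) /\ P (at_time (- snorm a) a)) ->
  forall v, P v.
Proof.
move=> PD PZ a00 Pnear.
have sp a : P (at_time (snorm a) a) /\ P (at_time (- snorm a) a) ->
  P (at_time 0 a).
  move=> [h1 h2]; have := PZ 2^-1 _ (PD _ _ h1 h2).
  rewrite at_timeD subrr at_timeZ mulr0.
  by rewrite (_ : a + a = 2 *: a) ?scalerA ?mulVf ?scale1r ?pnatr_eq0//
    scaler_nat mulr2n.
have pe : P (at_time 1 0).
  have [h1 h2] := nbhs_singleton Pnear.
  have := PZ (2 * snorm a0)^-1 _ (PD _ _ h1 (PZ (-1) _ h2)).
  rewrite at_timeZ at_timeD at_timeZ scaleN1r subrr scaler0.
  rewrite mulN1r opprK (_ : _ * _ = 1)//.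
  by field.
(* A small multiple of [q] is the difference of two spatial vectors close to [a0]; it is scaled back
   afterwards. *)
have pq q : P (at_time 0 q).
  have : \forall h \near (0 : R), P (at_time 0 (a0 + h *: q)).
    have : \forall h \near (0 : R), P (at_time (snorm (a0 + h *: q)) (a0 + h *:
      q)) /\
        P (at_time (- snorm (a0 + h *: q)) (a0 + h *: q)).
      apply: (@line_continuous R _ a0 q 0 [set a | P (at_time (snorm a) a) /\
        P (at_time (- snorm a) a)]); rewrite scale0r addr0; exact: Pnear.
    by apply: filterS => h /sp.
  move=> /nbhs_ballP[e /= e0] H.
  have he : P (at_time 0 (a0 + (e / 2) *: q)).
    apply: H; rewrite /ball/= sub0r normrN gtr0_norm ?divr_gt0//.
    by rewrite ltr_pdivrMr// ltr_pMr// ltr1n.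
  have := PZ (e / 2)^-1 _ (PD _ _ he (PZ (-1) _ (sp _ (nbhs_singleton Pnear)))).
  rewrite at_timeZ at_timeD at_timeZ !mulr0 addr0 mulr0 scaleN1r addrAC subrr
    add0r.
  by rewrite scalerA mulVf ?scale1r// gt_eqF// divr_gt0.
move=> v; have := PD _ _ (PZ (v 0 0) _ pe) (pq v).
by rewrite at_timeZ at_timeD scaler0 add0r addr0 mulr1 at_time_id.
Qed.

End space_part.

(** * Light rays, the cylinder and the causal diamond *)

Section causality.
Variable R : realType.
Implicit Types (x y z v w a p : spacetime R) (k t eps : R).

Lemma mho_open eps x : mho eps x -> \forall y \near x, mho eps y.
Proof.
move=> [/andP[x0 x1] xe].
have c0 : {for x, continuous (fun y : spacetime R =>
  y 0 0)} by exact: coord_continuous.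
have cn : {for x, continuous (@snorm R)} by exact: snorm_continuous.
near=> y; split.
  apply/andP; split; near: y.
    exact: (cvgr_gt _ c0).
  exact: (cvgr_lt _ c0).
near: y; exact: (cvgr_lt _ cn).
Unshelve. all: by end_near. Qed.

Lemma mho_segment eps x v s : mho eps x -> mho eps (x + v) -> 0 <= s <= 1 ->
  mho eps (x + s *: v).
Proof.
move=> [/andP[x0 x1] xe] [/andP[] + + +] /andP[s0 s1]; rewrite !mxE => y0 y1 ye.
split; first by rewrite !mxE; have [v0|v0] := leP 0 (v 0 0); apply/andP; split;
  nra.
have -> : x + s *: v = (1 - s) *: x + s *: (x + v).
  by rewrite scalerDr addrA -scalerDl subrK scale1r.
apply: (le_lt_trans (snorm_triangle _ _)).
rewrite !snormZ !ger0_norm ?subr_ge0//.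
have xe' : snorm x < eps by []. have ye' : snorm (x + v) < eps by [].
have [->|s0'] := eqVneq s 0; first by rewrite subr0 mul1r mul0r addr0.
have {s0'} : 0 < s by rewrite lt0r s0' s0.
nra.
Qed.

Lemma derive1n_cst (c : spacetime R) (k : nat) : derive1n k (cst c) = cst c \/
  derive1n k (cst c) = cst (0 : spacetime R).
Proof.
elim: k => [|k IH]; first by left.
right; rewrite derive1nS; case: IH => ->; by apply/funext => s;
  rewrite derive1_cst.
Qed.

Lemma smooth_line p v : smooth_curve (fun s => p + s *: v).
Proof.
case=> [|k] s; first exact: (@ex_derive _ _ _ _ _ _ _ (is_derive_line p v s)).
rewrite derive1Sn (_ : derive1 _ = cst v); last by apply/funext => r;
  rewrite derive1_line.
by case: (derive1n_cst v k) => ->; exact: derivable_cst.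
Qed.

Lemma causal_lt_line x v : lightlike v -> 0 < v 0 0 -> causal_lt x (x + v).
Proof.
move=> [v0 vv] vt; split.
  right; exists (fun s => x + s *: v), 0, 1; split=> //.
  - split; first exact: smooth_line.
    by move=> s _; rewrite derive1_line; split=> //; rewrite vv.
  - by rewrite scale0r addr0.
  - by rewrite scale1r.
by move/eqP; rewrite -subr_eq0 opprD addrA subrr sub0r oppr_eq0 => /eqP.
Qed.

Lemma light_related_line x v : lightlike v -> light_related x (x + v).
Proof.
move=> lv; exists (fun s => x + s *: v), 0, 1; split.
- by exists x, v.
- by rewrite scale0r addr0.
- by rewrite scale1r.
Qed.

(** Fixes the convention used below: both ends are the vertex minus a null vector, future pointing
    for the initial end and past pointing for the final one, so that the two legs can be treated
    alike. *)
Lemma broken_raysI eps y v w : lightlike v -> 0 < v 0 0 -> lightlike w ->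
  w 0 0 < 0 -> mho eps (y - v) -> mho eps (y - w) -> ~ mho eps y ->
  broken_rays eps (y - v) y (y - w).
Proof.
move=> lv v0 lw w0 mv mw my.
have lNw : lightlike (- w) by rewrite -scaleN1r; apply: lightlikeZ => //;
  rewrite oppr_eq0 oner_neq0.
have Nw0 : 0 < (- w) 0 0 by rewrite mxE oppr_gt0.
split=> //; split.
- by rewrite -[X in light_related _ X](subrK v); exact: light_related_line.
- exact: light_related_line.
- by rewrite -[X in causal_lt _ X](subrK v); exact: causal_lt_line.
- exact: causal_lt_line.
Qed.

(** For |a| <= 1 the function t - a.x does not decrease along causal curves, because the spatial
    length of a causal tangent is at most its time component. This replaces curves by linear
    inequalities, which are all that the diamond requires. *)
Lemma causal_le_sdot x y a : snorm a <= 1 -> causal_le x y ->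
  sdot a (y - x) <= (y - x) 0 0.
Proof.
move=> a1 [->|[g [s0 [s1 [s01 [sg cg] <- <-]]]]].
  by rewrite subrr mxE sdotC sdot0l.
pose F s := g s 0 0 - sdot a (g s).
pose dF s := derive1 g s 0 0 - sdot a (derive1 g s).
have dcoord s j : is_derive s (1 : R) (fun s => g s 0 j) (derive1 g s 0 j).
  have dg := sg 0%N s; rewrite derive1E derive_mx// mxE; apply: derivableP.
  by move/derivable_mxP : dg; exact.
have dFs (s : R) : is_derive s 1 F (dF s).
  have dsum : is_derive s 1 (fun s => sdot a (g s)) (sdot a (derive1 g s)).
    rewrite /sdot -big_filter [X in is_derive _ _ X _](_ : _ = fun s =>
      \sum_(j <- [seq j <- index_enum 'I_4 | j != 0]) a 0 j * g s 0 j);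
        last first.
      by apply/funext => r; rewrite big_filter.
    by apply: is_derive_bigsum => j; exact: is_derive_scale (dcoord s j).
  exact: is_derive_sub (dcoord s 0) dsum.
have dF0 (s : R) : s \in `[s0, s1] -> `|(0 : R)| <= dF s.
  rewrite in_itv/= => /cg[_]; rewrite minkowski_snorm => m t;
    rewrite normr0 subr_ge0.
  apply: (le_trans (sdot_le _ _)).
  apply: (@le_trans _ _ (snorm (derive1 g s))).
    by rewrite ler_piMl// snorm_ge0.
  rewrite -(@ler_pXn2r _ 2)// ?nnegrE ?snorm_ge0 ?(ltW t)//.
  by rewrite -subr_le0.
have := @le_increment R (cst 0) F (cst 0) dF s0 s1 (ltW s01)
  (fun s _ => @cst_continuous _ _ _ s) (fun s _ => is_derive_continuous (dFs s))
  (fun s _ => is_derive_cst (0 : R) s 1) (fun s _ => dFs s) dF0.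
rewrite subrr normr0 /F => h.
rewrite sdotDr sdotNr !mxE; lra.
Qed.

(** The vertex y sees the cylinder in the past and in the future, at two points over the same point
    of space. The same [a] serves for vertices near y, and vectors near [a] serve for y. *)
Definition visible eps y : Prop := exists a, [/\ snorm a != 0,
  mho eps (y - at_time (snorm a) a) & mho eps (y - at_time (- snorm a) a)].

Lemma unit_direction x : exists2 a, snorm a = 1 & forall j, j != 0 ->
  x 0 j = snorm x * a 0 j.
Proof.
have [x0|x0] := eqVneq (snorm x) 0.
  (* On the axis any unit vector will do. *)
  exists (delta_mx 0 1).
    rewrite snormE /sdot (bigD1 1)//= big1 ?addr0 ?mxE/= ?mulr1 ?sqrtr1// => j.
    by move=> /andP[_ j1]; rewrite mxE (negbTE j1) andbF mul0r.
  by move=> j j0; rewrite x0 mul0r snorm_eq0.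
exists ((snorm x)^-1 *: x).
  by rewrite snormZ ger0_norm ?invr_ge0 ?snorm_ge0// mulVf.
by move=> j _; rewrite mxE mulrA divff// mul1r.
Qed.

(** The search is radial. If [a] is the unit direction of y and r = |y|, the vector s a works as
    soon as max(0, r - eps) < s < min(y0, 1 - y0, r + eps), where y0 is the time of y. The interval
    is not empty: [causal_le_sdot] gives 0 < y0 < 1 with the zero vector, r - eps < y0 with [a] on
    the past side, and r - eps < 1 - y0 with [- a] on the future side. The midpoint is taken. *)
Lemma diamond_visible eps y : 0 < eps -> diamond eps y -> visible eps y.
Proof.
move=> eps0 [x mx [z mz [xy yz]]].
have {}xy : causal_le x y by []. have {}yz : causal_le y z by [].
have [a a1 ya] := unit_direction y.
move: mx mz => [/andP[x0 x1] xe] [/andP[z0 z1] ze].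
have {}xe : snorm x < eps by []. have {}ze : snorm z < eps by [].
have := sdot_le a x; have := sdot_le a z; rewrite a1 !mul1r => az ax.
have an : snorm (- a) <= 1 by rewrite snormN a1.
have a1le : snorm a <= 1 by rewrite a1.
have ay : sdot a y = snorm y.
  rewrite /sdot (eq_bigr (fun j => snorm y * (a 0 j * a 0 j))); last first.
    by move=> j j0; rewrite ya// mulrCA.
  by rewrite -mulr_sumr -[X in _ * X]sqr_snorm a1 expr1n mulr1.
have sn0 : snorm (0 : spacetime R) <= 1.
  by rewrite snorm0.
have := causal_le_sdot a1le xy; have := causal_le_sdot sn0 xy.
have := causal_le_sdot sn0 yz; have := causal_le_sdot an yz.
rewrite !sdot0l sdotNl !sdotDr !sdotNr ay !mxE => e1 e2 e3 e4.
pose r := snorm y; have r0 : 0 <= r by exact: snorm_ge0.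
pose lo := Num.max 0 (r - eps).
pose hi := Num.min (Num.min (y 0 0) (1 - y 0 0)) (r + eps).
have lohi : lo < hi.
  move: r0; rewrite /lo /hi gt_max !lt_min /r => r0; apply/andP; split;
    apply/andP; split;
    try (apply/andP; split); lra.
pose s := (lo + hi) / 2.
have los : lo < s by case: (midf_lt lohi).
have shi : s < hi by case: (midf_lt lohi).
move: los shi; rewrite /lo /hi gt_max !lt_min =>
  /andP[s0 s1] /andP[/andP[s2 s3] s4].
have sa : snorm (s *: a) = s by rewrite snormZ a1 mulr1 gtr0_norm.
have sy t : snorm (y - at_time t (s *: a)) < eps.
  rewrite (_ : snorm _ = snorm (at_time 0 ((r - s) *: a))).
    by rewrite snorm_at_time snormZ a1 mulr1 ltr_norml; apply/andP; split; lra.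
  rewrite /snorm; congr Num.sqrt; apply: eq_bigr => j j0; congr (_ ^+ 2).
  by rewrite !mxE (negbTE j0) ya// -/r mulrBl.
exists (s *: a); rewrite sa; split; first by rewrite gt_eqF.
  by split; [rewrite !mxE/=; apply/andP; split; lra|exact: sy].
by split; [rewrite !mxE/=; apply/andP; split; lra|exact: sy].
Qed.

Lemma mho_translate_open eps y v : mho eps (y - v) ->
  \forall p \near y, mho eps (p - v).
Proof.
move=> /mho_open h.
have c : {for y, continuous (fun p : spacetime R => p - v)}.
  have c1 : {for y, continuous (@id (spacetime R))} by exact: cvg_id.
  have c2 : {for y, continuous (@cst (spacetime R) (spacetime R) v)}.
    exact: cst_continuous.
  exact: continuousB c1 c2.
exact: c h.
Qed.

Lemma visible_open eps y : visible eps y -> \forall p \near y, visible eps p.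
Proof.
move=> [a [a0 /mho_translate_open m1 /mho_translate_open m2]].
by near=> p; exists a; split=> //; near: p.
Unshelve. all: by end_near. Qed.

Lemma visible_near eps y : visible eps y -> exists2 a0, snorm a0 != 0 &
  \forall a \near a0, [/\ snorm a != 0, mho eps (y - at_time (snorm a) a) &
                          mho eps (y - at_time (- snorm a) a)].
Proof.
move=> [a0 [a00 m1 m2]]; exists a0 => //.
have cs (f : spacetime R -> R) : {for a0, continuous f} ->
  mho eps (y - at_time (f a0) a0) ->
    \forall a \near a0, mho eps (y - at_time (f a) a).
  move=> cf /mho_open h.
  have c1 : {for a0, continuous (fun a => at_time (f a) a)}.
    exact: (@at_time_continuous _ _ f id _ cf (fun _ => id)).
  have c : {for a0, continuous (fun a => y - at_time (f a) a)}.
    have c2 : {for a0, continuous (@cst (spacetime R) (spacetime R) y)}.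
      exact: cst_continuous.
    exact: continuousB c2 c1.
  exact: c h.
have h1 := cs (@snorm R) (@snorm_continuous R a0) m1.
have cN : {for a0, continuous (fun a => - snorm a)}.
  exact: (continuousN (@snorm_continuous R a0)).
have h2 := cs (fun a => - snorm a) cN m2.
have h3 : \forall a \near a0, snorm a != 0.
  exact: (cvgr_neq0 _ (@snorm_continuous R a0)).
by apply: filterS3 h3 h1 h2 => a ? ? ?; split.
Qed.

End causality.

(** * Uniform increments *)

Lemma is_derive_along_line (R : realType) (V : normedModType R) (f : V -> R)
    (p v : V) (t d : R) :
  is_derive (p + t *: v) v f d <-> is_derive t 1 (fun s : R => f (p + s *: v)) d.
Proof.
have e : (fun h : R => h^-1 *: ((f \o shift (p + t *: v)) (h *: v) - f (p + t
  *: v))) =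
    (fun h : R => h^-1 *: (((fun s : R => f (p + s *: v)) \o shift t) (h *: 1)
                           - (fun s : R => f (p + s *: v)) t)).
  apply/funext => h /=; congr (_ *: (f _ - _)).
  by rewrite addrCA -scalerDl -[h *: 1]/(h * 1) mulr1.
split=> -[d1 d2]; apply: DeriveDef.
- by move: d1; rewrite /derivable e.
- by move: d2; rewrite /derive e.
- by move: d1; rewrite /derivable -e.
- by move: d2; rewrite /derive -e.
Qed.

(* The increments of f in the direction v are, locally uniformly in the base
   point, linear of slope d up to an error e: with d = 0 a Lipschitz bound, for
   all e > 0 strict differentiability.  Unlike mere directional
   differentiability, this passes to sums of directions. *)
Definition increment_bound (R : realType) (V : normedModType R) (f : V -> R)
    (p0 v : V) (d e : R) : Prop :=
  exists2 delta, 0 < delta & forall p h, `|p - p0| < delta -> `|h| < delta ->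
    `|f (p + h *: v) - f p - h * d| <= e * `|h|.

Section increments.
Variables (R : realType) (V : normedModType R) (f : V -> R) (p0 : V).
Implicit Types (v w p : V) (d e k h : R).

Lemma shift_ball (delta : R) w : 0 < delta ->
  exists2 eta, 0 < eta <= delta & forall p h, `|p - p0| < eta -> `|h| < eta ->
    `|p + h *: w - p0| < delta.
Proof.
move=> d0; have w0 := normr_ge0 w.
have w2 : 0 < 2 + `|w| by lra.
exists (delta / (2 + `|w|)).
  by rewrite divr_gt0//= ler_pdivrMr// ler_peMr ?ltW//; lra.
move=> p h hp hh; have -> : p + h *: w - p0 = (p - p0) + h *: w by rewrite addrAC.
apply: (le_lt_trans (ler_normD _ _)); rewrite normrZ.
set q := delta / _ in hp hh *.
have q0 : 0 < q by rewrite divr_gt0.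
have qE : q * (2 + `|w|) = delta by rewrite divfK// gt_eqF.
have : `|h| * `|w| <= q * `|w| by rewrite ler_wpM2r// ltW.
nra.
Qed.

(** The step h (v + w) is made as h w from p and then h v from p + h w. The second base point moves
    with h, and the uniformity in p of [increment_bound] absorbs this. *)
Lemma increment_boundD v w d d' e e' :
  increment_bound f p0 v d e -> increment_bound f p0 w d' e' ->
  increment_bound f p0 (v + w) (d + d') (e + e').
Proof.
move=> [d1 d10 H1] [d2 d20 H2].
have [eta /andP[eta0 etad] He] := shift_ball w d10.
exists (Num.min eta d2); first by rewrite lt_min eta0.
move=> p h; rewrite !lt_min => /andP[p1 p2] /andP[h1 h2].
have -> : p + h *: (v + w) = (p + h *: w) + h *: v.
  by rewrite scalerDr addrA addrAC.
have -> : f (p + h *: w + h *: v) - f p - h * (d + d') =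
  (f (p + h *: w + h *: v) - f (p + h *: w) - h * d) +
  (f (p + h *: w) - f p - h * d') by ring.
apply: (le_trans (ler_normD _ _)); rewrite mulrDl; apply: lerD; last exact: H2.
by apply: H1; [exact: He|exact: lt_le_trans h1 etad].
Qed.

Lemma increment_boundZ k v d e : increment_bound f p0 v d e ->
  increment_bound f p0 (k *: v) (k * d) (e * `|k|).
Proof.
move=> [d1 d10 H1]; have k0 := normr_ge0 k.
have k1 : 0 < 1 + `|k| by lra.
exists (d1 / (1 + `|k|)); first by rewrite divr_gt0.
move=> p h hp; rewrite ltr_pdivlMr// => hh.
rewrite scalerA mulrA -[leRHS]mulrA [`|k| * `|h|]mulrC -normrM; apply: H1.
  apply: (lt_le_trans hp); rewrite ler_pdivrMr// ler_peMr ?(ltW d10)//; lra.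
by rewrite normrM; have := normr_ge0 h; nra.
Qed.

(** Mean value estimate for s -> f (p + s v) - s d between 0 and h. It is used with [d = 0] when the
    derivative is merely bounded, and with small [e] once the derivative is known to be continuous
    at p0. *)
Lemma derive_increment_bound (g : V -> R) v d e (delta : R) : 0 < delta ->
  (forall p, `|p - p0| < delta -> is_derive p v f (g p) /\ `|g p - d| <= e) ->
  increment_bound f p0 v d e.
Proof.
move=> d0 H; have [eta /andP[eta0 etad] He] := shift_ball v d0.
exists eta => // p h hp hh.
pose F s := f (p + s *: v) - s * d; pose G s := e * s.
have dF (s : R) : `|s| <= `|h| -> is_derive s 1 F (g (p + s *: v) - d).
  move=> sh; have [+ _] := H _ (He p s hp (le_lt_trans sh hh)).
  move=> /is_derive_along_line d1; apply: is_derive_sub d1 _.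
  have := is_derive_mul (is_derive_id s (1 : R)) (is_derive_cst d s 1).
  by rewrite mul1r mulr0 addr0.
have dG (s : R) : is_derive s 1 G e.
  by have := is_derive_scale e (is_derive_id s (1 : R)); rewrite mulr1.
have FG (s : R) : `|s| <= `|h| -> `|g (p + s *: v) - d| <= e.
  by move=> sh; have [_] := H _ (He p s hp (le_lt_trans sh hh)).
have key a b : a <= b -> (forall s : R, a <= s <= b -> `|s| <= `|h|) ->
    `|F b - F a| <= G b - G a.
  move=> ab sub; apply: (@le_increment _ F G (fun s =>
    g (p + s *: v) - d) (fun=> e)) => //.
  - by move=> s; rewrite in_itv/= => /sub /dF; exact: is_derive_continuous.
  - by move=> s _; exact: is_derive_continuous (dG s).
  - by move=> s; rewrite in_itv/= => /andP[sa sb]; apply: dF; apply: sub;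
    rewrite !ltW.
  - by move=> s; rewrite in_itv/= => /sub; exact: FG.
have F0 : F 0 = f p by rewrite /F scale0r addr0 mul0r subr0.
have -> : f (p + h *: v) - f p - h * d = F h - F 0 by rewrite F0 /F; ring.
have [h0|h0] := leP 0 h.
  have : `|F h - F 0| <= G h - G 0.
    by apply: key => // s /andP[s0 sh]; rewrite !ger0_norm.
  by rewrite /G mulr0 subr0 (ger0_norm h0).
have : `|F 0 - F h| <= G 0 - G h.
  apply: key; first exact: ltW.
  by move=> s /andP[s0 sh]; rewrite (ltr0_norm h0) ler0_norm// lerN2.
by rewrite /G mulr0 sub0r -mulrN distrC (ltr0_norm h0).
Qed.

Lemma increment_bound_is_derive v d :
  (forall e, 0 < e -> increment_bound f p0 v d e) -> is_derive p0 v f d.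
Proof.
move=> H.
have c : (fun h : R => h^-1 *: ((f \o shift p0) (h *: v) - f p0)) @ 0^' --> d.
  apply/cvgrPdist_le => /= e e0; have [delta d0 Hd] := H e e0.
  have near0 : \forall h \near (0 : R)^', `|h| < delta /\ h != 0.
    near=> h; split; near: h; first exact: dnbhs0_lt.
    exact: nbhs_dnbhs_neq.
  apply: filterS near0 => h [hd h0].
  have := Hd p0 h; rewrite subrr normr0 => /(_ d0 hd).
  rewrite [h *: v + p0]addrC => h1.
  have hn : 0 < `|h| by rewrite normr_gt0.
  rewrite distrC -(ler_pM2r hn) -normrM.
  suff -> : (h^-1 *: (f (p0 + h *: v) - f p0) - d) * h = f (p0 + h *: v) - f p0
    - h * d by [].
  by rewrite -[_ *: _]/(_ * _); field.
apply: DeriveDef; first exact: cvgP c.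
exact: cvg_lim c.
Unshelve. all: by end_near. Qed.

End increments.

(** Walk from p0 to q one coordinate at a time. Every step starts at a new base point, still close
    to p0, and finitely many directions are involved; [K] bounds all coefficients at once and
    becomes the norm of q - p0. *)
Lemma lipschitz_continuous_rV (R : realType) (m : nat) (f : 'rV[R]_m ->
  R) (p0 : 'rV[R]_m) :
  (forall v, exists C, increment_bound f p0 v 0 C) -> {for p0, continuous f}.
Proof.
move=> H.
have key (r : seq 'I_m) : exists C, exists2 delta, 0 < delta &
    forall p (c : 'I_m -> R) K, `|p - p0| < delta -> K < delta ->
      (forall i, `|c i| <= K) ->
      `|f (p + \sum_(i <- r) c i *: basis_vec R i) - f p| <= C * K.
  elim: r => [|i r [C [d1 d10 IH]]].
    by exists 0, 1 => // p c K _ _ _; rewrite big_nil addr0 subrr normr0 mul0r.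
  have [C' [d2 d20 Hi]] := H (basis_vec R i).
  have [eta /andP[eta0 etad] He] := shift_ball p0 (basis_vec R i) d10.
  exists (C + `|C'|), (Num.min eta d2); first by rewrite lt_min eta0.
  move=> p c K; rewrite !lt_min => /andP[p1 p2] /andP[K1 K2] cK.
  have ci := le_lt_trans (cK i) K1.
  rewrite big_cons addrA.
  have := IH _ c K (He p (c i) p1 ci) (lt_le_trans K1 etad) cK.
  have := Hi p (c i) p2 (le_lt_trans (cK i) K2); rewrite mulr0 subr0.
  set q := p + _ => h1 h2.
  have -> : f (q + \sum_(j <- r) c j *: basis_vec R j) - f p =
    (f (q + \sum_(j <- r) c j *: basis_vec R j) - f q) + (f q - f p) by ring.
  apply: (le_trans (ler_normD _ _)); rewrite mulrDl; apply: lerD => //.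
  apply: (le_trans h1); apply: (@le_trans _ _ (`|C'| * `|c i|)).
    by rewrite ler_wpM2r// ler_norm.
  by rewrite ler_wpM2l.
have [C [d d0 Hd]] := key (index_enum 'I_m).
have c : f q @[q --> p0] --> f p0; last exact: c.
apply: (@cvgrPdist_le _ _ _ (nbhs p0) (nbhs_filter p0) f (f p0)).2 => /= e e0.
have C1 : 0 < 1 + `|C| by have := normr_ge0 C; lra.
apply/nbhs_ballP; exists (Num.min d ((1 + `|C|)^-1 * e)) => /=.
  by rewrite lt_min d0 mulr_gt0// invr_gt0.
move=> q; rewrite -ball_normE/= lt_min distrC => /andP[qd qe].
have := Hd p0 (fun i => (q - p0) 0 i) `|q - p0|.
rewrite subrr normr0 => /(_ d0 qd).
have -> : p0 + \sum_(i < m) (q - p0) 0 i *: basis_vec R i = q.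
  by rewrite -row_sum_delta subrKC.
have ci i : `|(q - p0) 0 i| <= `|q - p0|.
  rewrite [leRHS]/Num.Def.normr/= mx_normrE.
  exact: (le_bigmax _ (fun ij => `|(q - p0) ij.1 ij.2|) (0, i)).
move=> /(_ ci) h; rewrite distrC; apply: (le_trans h).
apply: (@le_trans _ _ ((1 + `|C|) * `|q - p0|)).
  by rewrite ler_wpM2r//; have := ler_norm C; lra.
by rewrite -ler_pdivlMl// ltW.
Qed.

(** * Smoothness classes *)

Lemma Ck_on_subset (R : realType) (m k : nat) (U V : set 'rV[R]_m) (f :
  'rV[R]_m -> R) :
  V `<=` U -> Ck_on k U f -> Ck_on k V f.
Proof.
move=> VU; elim: k f => [|k IH] f /= [c h]; split=> //.
- by move=> x /VU; exact: c.
- by move=> x /VU; exact: c.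
- by move=> j; have [d D] := h j; split; [move=> x /VU; exact: d|exact: IH].
Qed.

Section Ck_algebra.
Variables (R : realType) (m : nat) (U : set 'rV[R]_m).
Hypothesis openU : forall x, U x -> \forall y \near x, U y.
Implicit Types f g : 'rV[R]_m -> R.

Lemma Ck_on_pred k f : Ck_on k.+1 U f -> Ck_on k U f.
Proof.
elim: k f => [|k IH] f; first by move=> [c _].
by move=> [c h]; split=> // j; have [d D] := h j; split=> //; exact: IH.
Qed.

(** As U is open, equality on U is equality near each of its points, hence passes to derivatives.
    This permits replacing the derivative of a total function by a formula valid only on U. *)
Lemma Ck_on_eq k f g : (forall x, U x -> f x = g x) -> Ck_on k U f -> Ck_on k U g.
Proof.
have near_eq f' g' : (forall x, U x -> f' x = g' x) -> forall x, U x ->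
    \forall y \near x, f' y = g' y.
  by move=> fg x /openU; apply: filterS => y; exact: fg.
have cont f' g' : (forall x, U x -> f' x = g' x) ->
    (forall x, U x -> {for x, continuous f'}) ->
    forall x, U x -> {for x, continuous g'}.
  move=> fg cf x Ux.
  have c : f' y @[y --> x] --> f' x by exact: cf.
  suff c' : g' y @[y --> x] --> g' x by exact: c'.
  rewrite -fg// => P /c HP.
  have {}HP : \forall y \near x, P (f' y) by exact: HP.
  suff : \forall y \near x, P (g' y) by [].
  by apply: filterS2 HP (near_eq _ _ fg x Ux) => y + <-.
elim: k f g => [|k IH] f g fg [c h]; split=> //; try exact: cont fg c.
move=> j; have [d D] := h j; split.
  by move=> x Ux; apply: near_eq_derivable (d x Ux); exact: near_eq.
apply: IH D => x Ux; apply: near_eq_derive; exact: (near_eq _ _ fg x Ux).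
Qed.

Lemma Ck_onD k f g : Ck_on k U f -> Ck_on k U g -> Ck_on k U (fun x => f x + g x).
Proof.
elim: k f g => [|k IH] f g [cf hf] [cg hg]; split=> //.
- by move=> x Ux; exact: continuousD (cf x Ux) (cg x Ux).
- by move=> x Ux; exact: continuousD (cf x Ux) (cg x Ux).
move=> j; have [df Df] := hf j; have [dg Dg] := hg j; split.
  by move=> x Ux; exact: derivableD (df x Ux) (dg x Ux).
apply: Ck_on_eq (IH _ _ Df Dg) => x Ux.
by rewrite (deriveD (df x Ux) (dg x Ux)).
Qed.

Lemma Ck_onN k f : Ck_on k U f -> Ck_on k U (fun x => - f x).
Proof.
elim: k f => [|k IH] f [cf hf]; split=> //.
- by move=> x Ux; exact: continuousN (cf x Ux).
- by move=> x Ux; exact: continuousN (cf x Ux).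
move=> j; have [df Df] := hf j; split.
  by move=> x Ux; exact: derivableN (df x Ux).
apply: Ck_on_eq (IH _ Df) => x Ux.
by rewrite (deriveN (df x Ux)).
Qed.

Lemma Ck_onM k f g : Ck_on k U f -> Ck_on k U g -> Ck_on k U (fun x => f x * g x).
Proof.
elim: k f g => [|k IH] f g Cf Cg; have [cf hf] := Cf; have [cg hg] := Cg;
  split=> //.
- by move=> x Ux; exact: continuousM (cf x Ux) (cg x Ux).
- by move=> x Ux; exact: continuousM (cf x Ux) (cg x Ux).
move=> j; have [df Df] := hf j; have [dg Dg] := hg j; split.
  by move=> x Ux; exact: derivableM (df x Ux) (dg x Ux).
apply: Ck_on_eq (Ck_onD (IH _ _ (Ck_on_pred Cf) Dg) (IH _ _ (Ck_on_pred Cg)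
  Df)) => x Ux.
by rewrite (deriveM (df x Ux) (dg x Ux)).
Qed.

Lemma Ck_on_cst k (c : R) : Ck_on k U (cst c).
Proof.
elim: k c => [|k IH] c; split=> //; try by move=> x _; exact: cst_continuous.
move=> j; split; first by move=> x _; exact: derivable_cst.
by apply: Ck_on_eq (IH 0) => x _; rewrite derive_cst.
Qed.

Lemma Ck_on_sum k (I : Type) (r : seq I) (f : I -> 'rV[R]_m -> R) :
  (forall i, Ck_on k U (f i)) -> Ck_on k U (fun x => \sum_(i <- r) f i x).
Proof.
move=> h; elim: r => [|i r IH].
  by apply: Ck_on_eq (Ck_on_cst k 0) => x _; rewrite big_nil.
by apply: Ck_on_eq (Ck_onD (h i) IH) => x _; rewrite big_cons.
Qed.

Definition complex_Ck_on k (f : 'rV[R]_m -> R[i]) : Prop :=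
  Ck_on k U (fun x => complex.Re (f x)) /\ Ck_on k U (fun x => complex.Im (f x)).

Lemma complex_Ck_on_mul_sum k (I : Type) (r : seq I) (f g : I -> 'rV[R]_m ->
  R[i]) :
  (forall i, complex_Ck_on k (f i)) -> (forall i, complex_Ck_on k (g i)) ->
  complex_Ck_on k (fun x => \sum_(i <- r) f i x * g i x).
Proof.
move=> hf hg; split.
  apply: (@Ck_on_eq _ (fun x => \sum_(i <- r) (complex.Re (f i x) * complex.Re
    (g i x)
      - complex.Im (f i x) * complex.Im (g i x)))).
    by move=> x _; rewrite Re_sum; apply: eq_bigr => i _; rewrite Re_mul.
  apply: Ck_on_sum => i; have [? ?] := hf i; have [? ?] := hg i.
  by apply: Ck_onD; [|apply: Ck_onN]; exact: Ck_onM.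
apply: (@Ck_on_eq _ (fun x => \sum_(i <- r) (complex.Re (f i x) * complex.Im (g
  i x)
    + complex.Im (f i x) * complex.Re (g i x)))).
  by move=> x _; rewrite Im_sum; apply: eq_bigr => i _; rewrite Im_mul.
apply: Ck_on_sum => i; have [? ?] := hf i; have [? ?] := hg i.
by apply: Ck_onD; exact: Ck_onM.
Qed.

Lemma complex_Ck_on_sub k (f g : 'rV[R]_m -> R[i]) :
  complex_Ck_on k f -> complex_Ck_on k g -> complex_Ck_on k (fun x => f x - g x).
Proof.
move=> [fr fi] [gr gi]; split.
  apply: Ck_on_eq (Ck_onD fr (Ck_onN gr)) => x _; by rewrite Re_add Re_opp.
apply: Ck_on_eq (Ck_onD fi (Ck_onN gi)) => x _; by rewrite Im_add Im_opp.
Qed.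

End Ck_algebra.

(* Bootstrapping: the right-hand side of [du = u B - A u] is as smooth as u. *)
Lemma gauge_equation_smooth (R : realType) (n : nat) (U : set (spacetime R))
    (A B : one_form R n) (u : spacetime R -> 'M[R[i]]_n) :
  (forall x, U x -> \forall y \near x, U y) ->
  hermitian_connection A -> hermitian_connection B ->
  (forall x a b, U x -> {for x, continuous (fun y => complex.Re (u y a b))} /\
                        {for x, continuous (fun y => complex.Im (u y a b))}) ->
  (forall x j, U x ->
    mx_is_derive x (basis_vec R j) u (u x *m B j x - A j x *m u x)) ->
  mx_smooth_on U u.
Proof.
move=> oU hA hB cu du.
suff C k a b : complex_Ck_on U k (fun x => u x a b).
  by move=> a b; split=> k; have [] := C k a b.
elim: k a b => [|k IH] a b.
  by split; split=> // x Ux; have [] := cu x a b Ux.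
have CA (F : one_form R n) j a' b' : hermitian_connection F ->
    complex_Ck_on U k (fun x => F j x a' b').
  move=> hF; have [sr si] := (hF j).1 a' b'.
  split; first by apply: (@Ck_on_subset _ _ _ setT) (sr k).
  by apply: (@Ck_on_subset _ _ _ setT) (si k).
have CD j : complex_Ck_on U k (fun x => (u x *m B j x - A j x *m u x) a b).
  have := complex_Ck_on_sub oU
    (complex_Ck_on_mul_sum oU (index_enum 'I_n) (fun i => IH a i) (fun i =>
      CA B j i b hB))
    (complex_Ck_on_mul_sum oU (index_enum 'I_n) (fun i =>
      CA A j a i hA) (fun i => IH i b)).
  move=> [hr hi]; split.
    by apply: Ck_on_eq hr => // x _; rewrite !mxE.
  by apply: Ck_on_eq hi => // x _; rewrite !mxE.
split; split.
- by move=> x Ux; have [] := cu x a b Ux.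
- move=> j; split=> [x Ux|]; first by have [[]] := du x j Ux a b.
  apply: Ck_on_eq (CD j).1 => // x Ux.
  by apply/esym; apply: derive_val; have [] := du x j Ux a b.
- by move=> x Ux; have [] := cu x a b Ux.
- move=> j; split=> [x Ux|]; first by have [_ []] := du x j Ux a b.
  apply: Ck_on_eq (CD j).2 => // x Ux.
  by apply/esym; apply: derive_val; have [] := du x j Ux a b.
Qed.

(** * The connections agree on the cylinder *)

(* Comparing the difference quotients at h and h / 2 eliminates f 0. *)
Lemma is_derive_right_cst (R : realType) (f : R -> R) (d c : R) :
  is_derive (0 : R) 1 f d -> (forall s, 0 < s <= 1 -> f s = c) -> d = 0.
Proof.
move=> [df dE] fc; apply/eqP; rewrite -normr_le0 leNgt; apply/negP => d0.
have : (fun h : R => h^-1 *: ((f \o shift 0) (h *: 1) - f 0)) @ 0^' --> d.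
  by rewrite -dE; exact: df.
(* If q is the quotient at h, the quotient at h / 2 is 2 q. Both lie within |d| / 4 of d, so |d| =
   |2 (d - q) - (d - 2 q)| <= 3 |d| / 4, a contradiction. *)
move/cvgrPdist_le => /(_ (`|d| / 4)); rewrite divr_gt0// => /(_ isT).
move=> /nbhs_ballP[e /= e0 He].
have hb (h : R) : 0 < h -> h < e -> h <= 1 -> `|d - h^-1 * (c - f 0)| <= `|d| / 4.
  move=> h0 he h1.
  have := He h; rewrite -ball_normE/= sub0r normrN gtr0_norm// => /(_ he).
  rewrite gt_eqF// => /(_ isT); rewrite -[h *: 1]/(h * 1) mulr1 addr0 fc//.
  by rewrite h0.
pose h := Num.min (e / 2) 1.
have h0 : 0 < h by rewrite lt_min divr_gt0//= ltr01.
have h1 : h <= 1 by rewrite ge_min lexx orbT.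
have he : h < e.
  by rewrite (@le_lt_trans _ _ (e / 2))// ?ge_min ?lexx//; lra.
have := hb h h0 he h1; have := hb (h / 2).
rewrite divr_gt0// => /(_ isT); have -> : h / 2 < e by lra.
have -> : h / 2 <= 1 by lra.
move=> /(_ isT isT); rewrite invfM invrK.
have -> : h^-1 * 2 * (c - f 0) = 2 * (h^-1 * (c - f 0)) by ring.
set q := h^-1 * _; rewrite !ler_norml => /andP[? ?] /andP[? ?].
have [nd|nd] : `|d| = d \/ `|d| = - d by case: (ger0P d); [left|right].
  by move: d0; lra.
by move: d0; lra.
Qed.

Lemma mx_eq_on_columns (R : pzRingType) (m n : nat) (M N : 'M[R]_(m, n)) :
  (forall c : 'cV[R]_n, M *m c = N *m c) -> M = N.
Proof. by move=> h; apply/matrixP => i j; have /colP/(_ i) := h (delta_mx j 0);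
  rewrite -!colE !mxE. Qed.

Section two_connections.
Variables (R : realType) (n : nat) (A B : one_form R n).
Hypotheses (hA : hermitian_connection A) (hB : hermitian_connection B).
Implicit Types (x y v w a p : spacetime R) (s t : R).

(** Both frames are the identity at 0, so the derivative of [(PB s)^t* *m PA s] there is
    [pairing A y v - pairing B y v]. Constancy is available for s > 0 only, whence
    [is_derive_right_cst]. *)
Lemma frames_cst_pairing y v PA PB (K : 'M[R[i]]_n) :
  frame A y (- v) PA -> frame B y (- v) PB ->
  (forall s, 0 < s <= 1 -> (PB s)^t* *m PA s = K) ->
  pairing A y v = pairing B y v.
Proof.
move=> fA fB hK.
have z02 : 0 <= (0 : R) <= 2 by rewrite lexx ler0n.
have := mx_is_derive_mul (mx_is_derive_adj (frame_derive fB z02)) (frame_derive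
  fA z02).
rewrite scale0r addr0 fA.1 fB.1 !mulmx1 trmx1 map_mx1 mul1mx.
rewrite adj_opp pairing_skew// opprK !pairingN opprK.
set D := _ + _ => dD.
have D0 : D = 0.
  apply/matrixP => a b; rewrite [RHS]mxE; have [dr di] := dD a b.
  apply: complex_eqP.
    apply: (is_derive_right_cst dr (c := complex.Re (K a b))) => s s01.
    by rewrite hK.
  apply: (is_derive_right_cst di (c := complex.Im (K a b))) => s s01.
  by rewrite hK.
by move/eqP: D0; rewrite /D addrC subr_eq0 => /eqP.
Qed.

(** With frames starting at the vertex, the transform is [Q t *m (P s)^t*]. Multiplying the equality
    of transforms by [(QB t)^t*] on the left and by [PA s] on the right separates s from t, so that
    each side of the conclusion is constant. *)
Lemma broken_frames y v w PA PB QA QB s t :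
  frame A y (- v) PA -> frame B y (- v) PB ->
  frame A y (- w) QA -> frame B y (- w) QB ->
  lightlike v -> lightlike w -> 0 < s <= 1 -> 0 < t <= 1 ->
  broken_transform A (y - t *: w) y (y - s *: v) =1
    broken_transform B (y - t *: w) y (y - s *: v) ->
  (QB t)^t* *m QA t = (PB s)^t* *m PA s.
Proof.
move=> fPA fPB fQA fQB lv lw /andP[s0 s1] /andP[t0 t1] hS.
have lNv : lightlike (- v) by rewrite -scaleN1r; apply: lightlikeZ => //;
  rewrite oppr_eq0 oner_neq0.
have lNw : lightlike (- w) by rewrite -scaleN1r; apply: lightlikeZ => //;
  rewrite oppr_eq0 oner_neq0.
have z02 : 0 <= (0 : R) <= 2 by rewrite lexx ler0n.
have s02 : 0 <= s <= 2 by apply/andP; split; lra.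
have t02 : 0 <= t <= 2 by apply/andP; split; lra.
have tr (F : one_form R n) (p q : R ->
  'M[R[i]]_n) (hF : hermitian_connection F) (fp : frame F y (- v) p)
    (fq : frame F y (- w) q) c :
    broken_transform F (y - t *: w) y (y - s *: v) c = q t *m (p s)^t* *m c.
  rewrite /broken_transform /=.
  have := ptransport_frame hF c fp lNv s02 z02 (lt0r_neq0 s0).
  rewrite scale0r addr0 scalerN fp.1 mul1mx => ->.
  have := ptransport_frame hF ((p s)^t* *m c) fq lNw z02 t02.
  rewrite eq_sym => /(_ (lt0r_neq0 t0)).
  by rewrite scale0r addr0 scalerN fq.1 trmx1 map_mx1 mulmx1 mulmxA => ->.
have e1 : QA t *m (PA s)^t* = QB t *m (PB s)^t*.
  by apply: mx_eq_on_columns => c; rewrite -(tr A)// -(tr B)//; exact: hS.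
have := congr1 (fun M => (QB t)^t* *m M *m PA s) e1.
rewrite !mulmxA (frame_adjK fQB t02) mul1mx => <-.
by rewrite -[in RHS]mulmxA (frame_adjK fPA s02) mulmx1.
Qed.

Lemma broken_transform_pairing (e : R) y v w :
  lightlike v -> 0 < v 0 0 -> lightlike w -> w 0 0 < 0 -> ~ mho e y ->
  (forall s, 0 < s <= 1 -> mho e (y - s *: v) /\ mho e (y - s *: w)) ->
  (forall x y z, broken_rays e x y z ->
     broken_transform A z y x =1 broken_transform B z y x) ->
  pairing A y v = pairing B y v /\ pairing A y w = pairing B y w.
Proof.
move=> lv v0 lw w0 ny my hS.
have [PA fPA] := frame_exists hA y (- v);
  have [PB fPB] := frame_exists hB y (- v).
have [QA fQA] := frame_exists hA y (- w);
  have [QB fQB] := frame_exists hB y (- w).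
have key s t : 0 < s <= 1 -> 0 < t <= 1 -> (QB t)^t* *m QA t = (PB s)^t* *m PA s.
  move=> s01 t01; apply: (broken_frames fPA fPB fQA fQB lv lw s01 t01).
  have [s0 _] := andP s01; have [t0 _] := andP t01.
  apply: hS; apply: broken_raysI => //.
  - by apply: lightlikeZ => //; rewrite gt_eqF.
  - by rewrite mxE mulr_gt0.
  - by apply: lightlikeZ => //; rewrite gt_eqF.
  - by rewrite mxE pmulr_rlt0.
  - exact: (my s s01).1.
  - exact: (my t t01).2.
have i1 : 0 < (1 : R) <= 1 by rewrite lexx ltr01.
split.
  by apply: (frames_cst_pairing fPA fPB (K := (QB 1)^t* *m QA 1)) => s s01;
    rewrite -(key s 1).
by apply: (frames_cst_pairing fQA fQB (K := (PB 1)^t* *m PA 1)) => s s01;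
  rewrite -(key 1 s).
Qed.

End two_connections.

Lemma sdot_continuous (R : realType) (y : spacetime R) : continuous (sdot y).
Proof.
move=> x.
rewrite (_ : sdot y = fun x : spacetime R =>
    \sum_(j <- [seq j <- index_enum 'I_4 | j != 0]) y 0 j * x 0 j).
  apply: continuous_bigsum => j.
  exact: (continuousM (@cst_continuous _ _ (y 0 j) x) (@coord_continuous _ _ _
    _ _ x)).
by apply/funext => z; rewrite big_filter.
Qed.

Lemma continuous_zero_off (R : realType) (f : R -> R) :
  {for 0, continuous f} -> (\forall h \near 0^', f h = 0) -> f 0 = 0.
Proof.
move=> cf f0.
have c1 : f h @[h --> 0^'] --> f 0 by move/continuous_withinNx : cf.
have c2 : f h @[h --> 0^'] --> (0 : R).
  apply: (cvg_trans (near_eq_cvg _) (cvg_cst 0)).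
  by apply: filterS f0 => h ->.
exact: (cvg_unique _ c1 c2).
Qed.

Section agreement.
Variables (R : realType) (n : nat) (eps0 : R) (A B : one_form R n).
Hypotheses (hA : hermitian_connection A) (hB : hermitian_connection B).
Hypothesis hS : forall eps : R, 0 < eps -> eps < eps0 ->
  forall x y z : spacetime R, broken_rays eps x y z ->
    broken_transform A z y x =1 broken_transform B z y x.
Implicit Types (x y v w a p : spacetime R) (s t : R).

(** Leaving y against a direction with y.a > 0 decreases the distance to the axis at first order.
    Short null segments over [a] thus lie, apart from y, in the cylinder of radius |y|, to which y
    itself does not belong. *)
Lemma short_null_inside y a : 0 < y 0 0 < 1 -> 0 < sdot y a ->
  exists2 k, 0 < k & forall s, 0 < s <= 1 ->
    mho (snorm y) (y - s *: (k *: at_time (snorm a) a)) /\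
    mho (snorm y) (y - s *: (k *: at_time (- snorm a) a)).
Proof.
move=> /andP[y0 y1] ya.
have a0 : 0 <= snorm a by exact: snorm_ge0.
(* With c = s m / q, the inequality c |a| < m keeps the time in (0, 1), and m q <= y.a keeps the
   quadratic term c^2 |a|^2 below the linear gain 2 c (y.a). *)
pose q := snorm a + 1; have q0 : 0 < q by rewrite /q; lra.
have aq : snorm a < q by rewrite /q; lra.
pose m := Num.min (Num.min (y 0 0) (1 - y 0 0)) (sdot y a / q).
have m0 : 0 < m by rewrite !lt_min y0 divr_gt0//= ?andbT; lra.
have m1 : m <= y 0 0 by rewrite !ge_min lexx.
have m2 : m <= 1 - y 0 0 by rewrite !ge_min lexx orbT.
have m3 : m * q <= sdot y a by rewrite -ler_pdivlMr// !ge_min lexx !orbT.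
exists (m / q); first exact: divr_gt0.
move=> s /andP[s0 s1].
pose c := s * (m / q); have c0 : 0 < c by rewrite mulr_gt0// divr_gt0.
have cq : c * q <= m.
  by rewrite /c mulrA divfK ?gt_eqF// ler_piMl// (ltW m0).
have ca : c * snorm a < m by apply: lt_le_trans cq; rewrite ltr_pM2l.
have sn t : snorm (y - s *: (m / q *: at_time t a)) < snorm y.
  rewrite scalerA -/c -(@ltr_pXn2r _ 2)// ?nnegrE ?snorm_ge0//.
  rewrite !sqr_snorm sdotDl !sdotDr !sdotNl !sdotNr !sdotZl !sdotZr.
  have -> : sdot (at_time t a) (at_time t a) = snorm a ^+ 2.
    by rewrite -sqr_snorm snorm_at_time.
  have e : sdot y (at_time t a) = sdot y a.
    by apply: eq_bigr => j j0; rewrite at_timeS.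
  rewrite (sdotC (at_time t a)) e.
  have : c * snorm a ^+ 2 < 2 * sdot y a.
    rewrite expr2 mulrA; apply: (@le_lt_trans _ _ (m * q)); last by lra.
    apply: (@le_trans _ _ (m * snorm a)); first by rewrite ler_wpM2r// ltW.
    by rewrite ler_wpM2l ?(ltW m0)// (ltW aq).
  nra.
have ca0 : 0 <= c * snorm a by rewrite mulr_ge0// ltW.
split; (split; last exact: sn); rewrite scalerA -/c !mxE/= ?mulrN; apply/andP;
  split; lra.
Qed.

(** The hypothesis is applied with radius |y|, which is admissible since |y| < eps0. Spatial vectors
    [a] close to y satisfy y.a > 0, so [null_span] can be based at y itself. *)
Lemma agree_off_axis y : mho eps0 y -> snorm y != 0 ->
  forall v, pairing A y v = pairing B y v.
Proof.
move=> [y01 ye] y0.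
have r0 : 0 < snorm y by rewrite lt0r y0 snorm_ge0.
apply: (@null_span _ _ y) => //.
- by move=> v w; rewrite !pairingD => -> ->.
- by move=> k v; rewrite !pairingZ => ->.
have c : {for y, continuous (sdot y)} by exact: sdot_continuous.
have : \forall a \near y, 0 < sdot y a.
  by apply: (cvgr_gt _ c); rewrite -sqr_snorm exprn_gt0.
apply: filterS => a ya.
have [k k0 Hk] := short_null_inside y01 ya.
have a0 : snorm a != 0.
  apply/eqP => a0; have := sdot_le y a; rewrite a0 mulr0; move: ya; lra.
have a1 : 0 < snorm a by rewrite lt0r a0 snorm_ge0.
have l1 : lightlike (k *: at_time (snorm a) a).
  by apply: lightlikeZ; rewrite ?gt_eqF//; apply: lightlike_at_time;
    rewrite // ger0_norm// ltW.
have l2 : lightlike (k *: at_time (- snorm a) a).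
  by apply: lightlikeZ; rewrite ?gt_eqF//; apply: lightlike_at_time;
    rewrite // normrN ger0_norm// ltW.
have [] := broken_transform_pairing hA hB l1 _ l2 _ _ Hk (hS r0 ye).
- by rewrite !mxE mulr_gt0.
- by rewrite !mxE pmulr_rlt0// oppr_lt0.
- by move=> [_]; rewrite -[X in X < _]/(snorm y) ltxx.
rewrite !pairingZ => h1 h2.
have kK (M : 'M[R[i]]_n) : (k^-1)%:C *: (k%:C *: M) = M.
  by rewrite scalerA -rmorphM/= mulVf ?gt_eqF// scale1r.
by split; [rewrite -[LHS]kK h1 kK|rewrite -[LHS]kK h2 kK].
Qed.

(** A point of the axis is approached along the first spatial coordinate, and continuity of both
    connections concludes. *)
Lemma connections_agree y j : mho eps0 y -> A j y = B j y.
Proof.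
move=> my; rewrite -!pairing_basis.
have [y0|] := eqVneq (snorm y) 0; last by move=> y0; exact: agree_off_axis.
pose l (h : R) : spacetime R := y + h *: delta_mx 0 1.
have cl : {for 0, continuous l} by exact: line_continuous.
have l0 : l 0 = y by rewrite /l scale0r addr0.
have nl : \forall h \near 0^', mho eps0 (l h) /\ snorm (l h) != 0.
  have ml : \forall h \near (0 : R), mho eps0 (l h).
    by apply: cl; rewrite l0; exact: mho_open.
  have : \forall h \near (0 : R)^', h != 0 by exact: nbhs_dnbhs_neq.
  move: ml => /nbhs_dnbhs; apply: filterS2 => h mh h0; split=> //.
  apply/eqP => /(@snorm_eq0 _ _ 1) /(_ isT);
    rewrite !mxE/= mulr1 snorm_eq0// add0r.
  by apply/eqP.
have cR (F : one_form R n) (hF : hermitian_connection F) (a b : 'I_n) :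
    {for 0, continuous (fun h => complex.Re (pairing F (l h) (basis_vec R j) a
      b))}.
  exact: (@continuous_comp _ _ _ l (fun x => complex.Re (pairing F x _ a b)) 0 cl
            (Re_pairing_continuous hF (x:=l 0))).
have cI (F : one_form R n) (hF : hermitian_connection F) (a b : 'I_n) :
    {for 0, continuous (fun h => complex.Im (pairing F (l h) (basis_vec R j) a
      b))}.
  exact: (@continuous_comp _ _ _ l (fun x => complex.Im (pairing F x _ a b)) 0 cl
            (Im_pairing_continuous hF (x:=l 0))).
apply/matrixP => a b; apply: complex_eqP; apply/eqP; rewrite -subr_eq0; apply/eqP.
  rewrite -l0.
  apply: (@continuous_zero_off _ (fun h =>
    complex.Re (pairing A (l h) (basis_vec R j) a b)
    - complex.Re (pairing B (l h) (basis_vec R j) a b))).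
    exact: continuousB (cR A hA a b) (cR B hB a b).
  by apply: filterS nl => h [mh h0]; rewrite agree_off_axis// subrr.
rewrite -l0.
apply: (@continuous_zero_off _ (fun h =>
  complex.Im (pairing A (l h) (basis_vec R j) a b)
  - complex.Im (pairing B (l h) (basis_vec R j) a b))).
  exact: continuousB (cI A hA a b) (cI B hB a b).
by apply: filterS nl => h [mh h0]; rewrite agree_off_axis// subrr.
Qed.

End agreement.

(** * The gauge transformation *)

Definition transport_mx (R : realType) (n : nat) (A : one_form R n)
    (y x : spacetime R) : 'M[R[i]]_n :=
  \matrix_(a, b) ptransport A y x (delta_mx b 0) a 0.

Section gauge.
Variables (R : realType) (n : nat) (eps0 : R) (A B : one_form R n).
Hypotheses (hA : hermitian_connection A) (hB : hermitian_connection B).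
Hypothesis hS : forall eps : R, 0 < eps -> eps < eps0 ->
  forall x y z : spacetime R, broken_rays eps x y z ->
    broken_transform A z y x =1 broken_transform B z y x.
Implicit Types (x y v w p : spacetime R) (s t h : R).

Lemma transport_mx_frame (F : one_form R n) (hF : hermitian_connection F) p v
  Phi s :
  frame F p v Phi -> lightlike v -> 0 < s <= 2 ->
  transport_mx F (p + s *: v) p = Phi s.
Proof.
move=> fP lv /andP[s0 s2]; apply/matrixP => a b; rewrite mxE.
have z02 : 0 <= (0 : R) <= 2 by rewrite lexx ler0n.
have s02 : 0 <= s <= 2 by rewrite ltW.
have := ptransport_frame hF (delta_mx b 0) fP lv z02 s02.
rewrite eq_sym (gt_eqF s0) => /(_ isT); rewrite scale0r addr0 => ->.
by rewrite fP.1 trmx1 map_mx1 mulmx1 -colE mxE.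
Qed.

(* [P^A_{y <- x} P^B_{x <- y}] with x = y - v. *)
Definition comparison y v : 'M[R[i]]_n :=
  transport_mx A y (y - v) *m (transport_mx B y (y - v))^t*.

Lemma comparison_frame p v PA PB s :
  frame A p v PA -> frame B p v PB -> lightlike v -> 0 < s <= 2 ->
  comparison (p + s *: v) (s *: v) = PA s *m (PB s)^t*.
Proof.
move=> fA fB lv s02.
by rewrite /comparison addrK (transport_mx_frame hA fA)// (transport_mx_frame
  hB fB).
Qed.

Lemma comparison_frame1 y v PA PB :
  frame A (y - v) v PA -> frame B (y - v) v PB -> lightlike v ->
  comparison y v = PA 1 *m (PB 1)^t*.
Proof.
move=> fA fB lv; have := comparison_frame fA fB lv (s := 1).
by rewrite scale1r subrK; apply; rewrite ltr01 ler1n.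
Qed.

Lemma one02 : 0 <= (1 : R) <= 2.
Proof. by rewrite ler01 ler1n. Qed.

Lemma comparison_unitary y v : lightlike v ->
  comparison y v *m (comparison y v)^t* = 1%:M.
Proof.
move=> lv; have [PA fA] := frame_exists hA (y - v) v.
have [PB fB] := frame_exists hB (y - v) v.
rewrite (comparison_frame1 fA fB lv) adj_mul trmxCK mulmxA -[_ *m PB 1]mulmxA.
by rewrite (frame_adjK fB one02) mulmx1 (frame_Kadj fA one02).
Qed.

(** By convexity the segment from y - v to y stays in the cylinder, where A = B. Both frames then
    solve one equation, and [(PB s)^t* *m PA s] keeps its initial value. *)
Lemma comparison_mho y v : lightlike v -> mho eps0 y -> mho eps0 (y - v) ->
  comparison y v = 1%:M.
Proof.
move=> lv my mx; have [PA fA] := frame_exists hA (y - v) v.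
have [PB fB] := frame_exists hB (y - v) v.
rewrite (comparison_frame1 fA fB lv).
apply: mulmx1C.
rewrite (@skew_flow_invariant R n n n (fun s =>
  pairing A (y - v + s *: v) v) PA PB 0 1)//.
- by rewrite fA.1 fB.1 mulmx1 trmx1 map_mx1.
- by move=> s _; exact: pairing_skew.
- by move=> s /andP[s0 s1]; apply: (frame_derive fA);
  rewrite s0 (le_trans s1)// ler1n.
- move=> s /andP[s0 s1].
  have ms : mho eps0 (y - v + s *: v) by apply: mho_segment; rewrite ?subrK// s0.
  have -> : pairing A (y - v + s *: v) v = pairing B (y - v + s *: v) v.
    by apply: eq_bigr => j _; rewrite (connections_agree hA hB hS).
  by apply: (frame_derive fB); rewrite s0 (le_trans s1)// ler1n.
Qed.

(** Outside the cylinder this is S^A = S^B with the transports from x moved to one side and those to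
    z to the other. Inside it both comparisons are the identity. *)
Lemma comparison_opposite y v w : lightlike v -> 0 < v 0 0 -> lightlike w ->
  w 0 0 < 0 -> mho eps0 (y - v) -> mho eps0 (y - w) ->
  comparison y v = comparison y w.
Proof.
move=> lv v0 lw w0 mv mw.
have [my|my] := pselect (mho eps0 y); first by rewrite !comparison_mho.
(* A radius strictly between those of the two ends and eps0: the ends remain inside, and y remains
   outside. *)
pose e := (Num.max (snorm (y - v)) (snorm (y - w)) + eps0) / 2.
have ve : snorm (y - v) < eps0 by case: mv.
have we : snorm (y - w) < eps0 by case: mw.
have me : Num.max (snorm (y - v)) (snorm (y - w)) < eps0 by rewrite gt_max ve we.
have e0 : e < eps0 by case: (midf_lt me).
have : Num.max (snorm (y - v)) (snorm (y - w)) < e by case: (midf_lt me).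
rewrite gt_max => /andP[ve' we'].
have e1 : 0 < e by exact: le_lt_trans (snorm_ge0 _) ve'.
have mye : ~ mho e y.
  move=> [y01 ye]; apply: my; split=> //; exact: lt_trans ye e0.
have mve : mho e (y - v) by case: mv.
have mwe : mho e (y - w) by case: mw.
have HS := hS e1 e0 (broken_raysI lv v0 lw w0 mve mwe mye).
have [PA fPA] := frame_exists hA (y - v) v;
  have [PB fPB] := frame_exists hB (y - v) v.
have [QA fQA] := frame_exists hA (y - w) w;
  have [QB fQB] := frame_exists hB (y - w) w.
have z02 : 0 <= (0 : R) <= 2 by rewrite lexx ler0n.
have tr (F : one_form R n) (P Q : R -> 'M[R[i]]_n) (hF : hermitian_connection F)
    (fP : frame F (y - v) v P) (fQ : frame F (y - w) w Q) c :
    broken_transform F (y - w) y (y - v) c = (Q 1)^t* *m P 1 *m c.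
  rewrite /broken_transform /=.
  have := ptransport_frame hF c fP lv z02 one02;
    rewrite eq_sym oner_neq0 => /(_ isT).
  rewrite scale0r addr0 scale1r subrK fP.1 trmx1 map_mx1 mulmx1 => ->.
  have := ptransport_frame hF (P 1 *m c) fQ lw one02 z02 (oner_neq0 _).
  by rewrite scale0r addr0 scale1r subrK fQ.1 mul1mx mulmxA => ->.
have e2 : (QA 1)^t* *m PA 1 = (QB 1)^t* *m PB 1.
  by apply: mx_eq_on_columns => c; rewrite -(tr A)// -(tr B)//; exact: HS.
rewrite (comparison_frame1 fPA fPB lv) (comparison_frame1 fQA fQB lw).
have := congr1 (fun M => QA 1 *m M *m (PB 1)^t*) e2.
rewrite !mulmxA (frame_Kadj fQA one02) mul1mx => ->.
by rewrite -[in LHS]mulmxA (frame_Kadj fPB one02) mulmx1.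
Qed.

(** The spatial vector is chosen point by point, without any continuity in y; [gaugeE] shows that
    the choice is immaterial at visible points. The default 0 is taken only where y is not
    visible. *)
Definition gauge y : 'M[R[i]]_n :=
  let a := xget 0 [set a | [/\ snorm a != 0, mho eps0 (y - at_time (snorm a) a)
                           & mho eps0 (y - at_time (- snorm a) a)]] in
  comparison y (at_time (snorm a) a).

(** A past pointing v is compared directly with the chosen future pointing vector. A future pointing
    v is compared with it through the past pointing vector over the same [a]. *)
Lemma gaugeE y v : visible eps0 y -> lightlike v -> mho eps0 (y - v) ->
  gauge y = comparison y v.
Proof.
move=> vy lv mv; rewrite /gauge.
have [a0 m1 m2] := xgetPex 0 vy; set a := xget 0 _ in a0 m1 m2 *.
have a1 : 0 < snorm a by rewrite lt0r a0 snorm_ge0.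
have l1 : lightlike (at_time (snorm a) a).
  by apply: lightlike_at_time; rewrite // ger0_norm// ltW.
have l2 : lightlike (at_time (- snorm a) a).
  by apply: lightlike_at_time; rewrite // normrN ger0_norm// ltW.
have t1 : 0 < at_time (snorm a) a 0 0 by rewrite at_time0.
have t2 : at_time (- snorm a) a 0 0 < 0 by rewrite at_time0 oppr_lt0.
have [v0|v0|v0] := ltgtP 0 (v 0 0).
- by rewrite (comparison_opposite l1 t1 l2 t2)// (comparison_opposite lv v0 l2
  t2).
- exact: comparison_opposite.
- by have [/eqP] := lightlike_snorm lv; rewrite -v0 normr0 => /eqP ->;
  rewrite eqxx.
Qed.

Lemma visible_lightlike y : visible eps0 y ->
  exists2 v, lightlike v & mho eps0 (y - v).
Proof.
move=> [a [a0 m1 _]]; exists (at_time (snorm a) a) => //.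
by apply: lightlike_at_time; rewrite // ger0_norm// snorm_ge0.
Qed.

Lemma gauge_unitary y : visible eps0 y -> gauge y *m (gauge y)^t* = 1%:M.
Proof.
move=> vy; have [v lv mv] := visible_lightlike vy.
by rewrite (gaugeE vy lv mv) comparison_unitary.
Qed.

Lemma gauge_mho y : visible eps0 y -> mho eps0 y -> gauge y = 1%:M.
Proof.
move=> vy my; have [v lv mv] := visible_lightlike vy.
by rewrite (gaugeE vy lv mv) comparison_mho.
Qed.

Definition gauge_rhs p v : 'M[R[i]]_n :=
  gauge p *m pairing B p v - pairing A p v *m gauge p.

(** The points p + s v lie on the ray from the fixed point p - v, at parameter 1 + s. By [gaugeE]
    one pair of frames therefore gives u at all of them, and the product rule applies at parameter
    1, in the interior of [0, 2]. *)
Lemma gauge_derive_null p v : visible eps0 p -> lightlike v -> mho eps0 (p - v) ->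
  mx_is_derive p v gauge (gauge_rhs p v).
Proof.
move=> vp lv mv.
have [PA fA] := frame_exists hA (p - v) v;
  have [PB fB] := frame_exists hB (p - v) v.
have gl : \forall s \near (0 : R),
  gauge (p + s *: v) = PA (1 * s + 1) *m (PB (1 * s + 1))^t*.
  have cl : {for 0, continuous (fun s : R =>
    p + s *: v)} by exact: line_continuous.
  have vis : \forall s \near (0 : R), visible eps0 (p + s *: v).
    by apply: cl; rewrite scale0r addr0; exact: visible_open.
  have s1 : \forall s \near (0 : R), `|s| < 1 by apply/nbhs0_lt.
  apply: filterS2 vis s1 => s vs; rewrite ltr_norml => /andP[s1 s2].
  have pE : p + s *: v = (p - v) + (1 + s) *: v by rewrite scalerDl scale1r
    addrA subrK.
  rewrite (@gaugeE _ ((1 + s) *: v))//.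
  - rewrite [X in comparison X _]pE mul1r [s + 1]addrC;
    apply: comparison_frame => //.
    by apply/andP; split; lra.
  - by apply: lightlikeZ => //; rewrite gt_eqF//; lra.
  - by rewrite scalerDl scale1r opprD addrACA subrr addr0.
have d1 : mx_is_derive (0 : R) 1 (fun s => PA (1 * s + 1) *m (PB (1 * s + 1))^t*)
    (gauge_rhs p v).
  have z : 1 * 0 + 1 = 1 :> R by rewrite mulr0 add0r.
  have := frame_derive fA one02; rewrite -{1}z => /mx_is_derive_comp_affine dA.
  have := frame_derive fB one02; rewrite -{1}z => /mx_is_derive_comp_affine dB.
  have := mx_is_derive_mul dA (mx_is_derive_adj dB).
  rewrite z !scale1r subrK /gauge_rhs (gaugeE vp lv mv) (comparison_frame1 fA
    fB lv).
  rewrite adj_opp adj_mul pairing_skew// !mulmxN opprK addrC mulNmx !mulmxA.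
  by [].
move=> a b; have [dr di] := d1 a b; split.
  have := (is_derive_along_line (fun y => complex.Re (gauge y a b)) p v 0
             (complex.Re (gauge_rhs p v a b))).2.
  rewrite scale0r addr0; apply; apply: near_eq_is_derive dr.
  by apply: filterS gl => s ->.
have := (is_derive_along_line (fun y => complex.Im (gauge y a b)) p v 0
           (complex.Im (gauge_rhs p v a b))).2.
rewrite scale0r addr0; apply; apply: near_eq_is_derive di.
by apply: filterS gl => s ->.
Qed.

End gauge.

(** * Regularity of the gauge transformation *)

Definition part (R : rcfType) (b : bool) (z : R[i]) : R :=
  if b then complex.Im z else complex.Re z.

(** A real-valued norm on complex numbers, subadditive and submultiplicative, that dominates both
    parts. *)
Definition abs1 (R : rcfType) (z : R[i]) : R := `|complex.Re z| + `|complex.Im z|.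

Section parts.
Variable R : rcfType.
Implicit Types z w : R[i].

Lemma partD b z w : part b (z + w) = part b z + part b w.
Proof. by case: b; [exact: Im_add|exact: Re_add]. Qed.

Lemma partZ b (k : R) z : part b (k%:C * z) = k * part b z.
Proof.
by case: b; rewrite /part ?Im_mul ?Re_mul/= mul0r ?addr0 ?subr0.
Qed.

Lemma part_le b z : `|part b z| <= abs1 z.
Proof. by rewrite /abs1; case: b; rewrite /part ?lerDl ?lerDr. Qed.

Lemma abs1_ge0 z : 0 <= abs1 z. Proof. by rewrite addr_ge0. Qed.

Lemma abs1D z w : abs1 (z + w) <= abs1 z + abs1 w.
Proof.
rewrite /abs1 Re_add Im_add.
have := ler_normD (complex.Re z) (complex.Re w).
have := ler_normD (complex.Im z) (complex.Im w); lra.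
Qed.

Lemma abs1N z : abs1 (- z) = abs1 z.
Proof. by rewrite /abs1 Re_opp Im_opp !normrN. Qed.

Lemma abs1M z w : abs1 (z * w) <= abs1 z * abs1 w.
Proof.
rewrite /abs1 Re_mul Im_mul.
have := ler_normB (complex.Re z * complex.Re w) (complex.Im z * complex.Im w).
have := ler_normD (complex.Re z * complex.Im w) (complex.Im z * complex.Re w).
rewrite !normrM; nra.
Qed.

Lemma abs1_sum (I : Type) (r : seq I) (f : I -> R[i]) :
  abs1 (\sum_(i <- r) f i) <= \sum_(i <- r) abs1 (f i).
Proof.
elim: r => [|i r IH]; first by rewrite !big_nil /abs1/= normr0 addr0.
by rewrite !big_cons; apply: (le_trans (abs1D _ _)); rewrite lerD2l.
Qed.

(** The diagonal entry of [U *m U^t*] is the sum of the squared moduli along row a, so both parts of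
    each entry are at most 1 in absolute value. *)
Lemma unitary_abs1_le n (U : 'M[R[i]]_n) a b : U *m U^t* = 1%:M ->
  abs1 (U a b) <= 2.
Proof.
move=> /matrixP/(_ a a); rewrite !mxE eqxx => /(congr1 (@complex.Re R)).
rewrite Re_sum/= => e.
have h : complex.Re (U a b) ^+ 2 + complex.Im (U a b) ^+ 2 <= 1.
  rewrite -e (bigD1 b)//= !mxE Re_mul Re_conjc Im_conjc mulrN opprK -!expr2 lerDl.
  apply: sumr_ge0 => i _; rewrite !mxE Re_mul Re_conjc Im_conjc mulrN opprK
    -!expr2.
  by rewrite addr_ge0// sqr_ge0.
have le1 (x : R) : x ^+ 2 <= 1 -> `|x| <= 1.
  by move=> x1; rewrite -(@ler_pXn2r _ 2)// ?nnegrE// expr1n real_normK ?num_real.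
have h1 : `|complex.Re (U a b)| <= 1 by apply: le1; apply: le_trans h;
  rewrite lerDl sqr_ge0.
have h2 : `|complex.Im (U a b)| <= 1 by apply: le1; apply: le_trans h;
  rewrite lerDr sqr_ge0.
by rewrite /abs1; lra.
Qed.

End parts.

Lemma increment_bound_le (R : realType) (V : normedModType R) (f : V -> R)
    (p0 v : V) (d e e' : R) : e <= e' ->
  increment_bound f p0 v d e -> increment_bound f p0 v d e'.
Proof.
move=> ee [dl dl0 H]; exists dl => // p h hp hh.
by apply: (le_trans (H p h hp hh)); rewrite ler_wpM2r.
Qed.

Section gauge_regularity.
Variables (R : realType) (n : nat) (eps0 : R) (A B : one_form R n).
Hypotheses (hA : hermitian_connection A) (hB : hermitian_connection B).
Hypothesis hS : forall eps : R, 0 < eps -> eps < eps0 ->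
  forall x y z : spacetime R, broken_rays eps x y z ->
    broken_transform A z y x =1 broken_transform B z y x.
Implicit Types (x y v w p : spacetime R) (s t h k : R).

Local Notation u := (gauge eps0 A B).
Local Notation rhs := (gauge_rhs eps0 A B).

Lemma gauge_rhsD p v w : rhs p (v + w) = rhs p v + rhs p w.
Proof. by rewrite /gauge_rhs !pairingD mulmxDr mulmxDl opprD addrACA. Qed.

Lemma gauge_rhsZ p k v : rhs p (k *: v) = k%:C *: rhs p v.
Proof. by rewrite /gauge_rhs !pairingZ -scalemxAl -scalemxAr scalerBr. Qed.

Definition null_derivative p0 v := exists2 delta, 0 < delta &
  forall p, `|p - p0| < delta -> visible eps0 p /\ mx_is_derive p v u (rhs p v).

(** Serves twice, for the Lipschitz bound and for strict differentiability. A property of directions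
    stable under linear combinations needs checking only on fixed null vectors along which u is
    differentiable at all points near p0; by openness of visibility these are plentiful enough for
    [null_span]. *)
Lemma null_directions_suffice p0 (P : spacetime R -> Prop) :
  visible eps0 p0 ->
  (forall v w, P v -> P w -> P (v + w)) -> (forall k v, P v -> P (k *: v)) ->
  (forall v, null_derivative p0 v -> P v) -> forall v, P v.
Proof.
move=> vis PD PZ H; have [a0 a00 near_a0] := visible_near vis.
apply: (null_span PD PZ a00); apply: filterS near_a0 => a [an0 m1 m2].
have a1 : 0 < snorm a by rewrite lt0r an0 snorm_ge0.
have key v : lightlike v -> mho eps0 (p0 - v) -> P v.
  move=> lv mv; apply: H.
  have : \forall p \near p0, visible eps0 p /\ mho eps0 (p - v).
    apply: filterS2 (visible_open vis) (mho_translate_open mv) => p h1 h2;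
      by split.
  move=> /nbhs_ballP[delta /= d0 Hd]; exists delta => // p hp.
  have [vp mp] : visible eps0 p /\ mho eps0 (p - v).
    by apply: Hd; rewrite -ball_normE/= distrC.
  by split=> //; exact: gauge_derive_null.
split; apply: key => //; apply: lightlike_at_time => //.
  by rewrite ger0_norm// ltW.
by rewrite normrN ger0_norm// ltW.
Qed.

Lemma part_derive b p v a c : mx_is_derive p v u (rhs p v) ->
  is_derive p v (fun y => part b (u y a c)) (part b (rhs p v a c)).
Proof. by move=> /(_ a c)[dr di]; case: b. Qed.

(** Nothing is known yet about the continuity of u. Its entries are bounded by 2 because it is
    unitary, and the entries of A and B are locally bounded by continuity. *)
Lemma gauge_rhs_bounded p0 v a c : exists C, \forall p \near p0,
  visible eps0 p -> abs1 (rhs p v a c) <= C.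
Proof.
pose g p := \sum_i (2 * abs1 (pairing B p v i c) + 2 * abs1 (pairing A p v a i)).
have cabs (F : one_form R n) (hF : hermitian_connection F) i j :
    continuous (fun p => abs1 (pairing F p v i j)).
  move=> p.
  have c1 : {for p, continuous (fun p => `|complex.Re (pairing F p v i j)|)}.
    exact: (@continuous_comp _ _ _ (fun p =>
      complex.Re (pairing F p v i j)) (@Num.norm _ R)
      p (Re_pairing_continuous hF (x := p)) (@norm_continuous _ _ _)).
  have c2 : {for p, continuous (fun p => `|complex.Im (pairing F p v i j)|)}.
    exact: (@continuous_comp _ _ _ (fun p =>
      complex.Im (pairing F p v i j)) (@Num.norm _ R)
      p (Im_pairing_continuous hF (x := p)) (@norm_continuous _ _ _)).
  exact: continuousD c1 c2.
have cg : {for p0, continuous g}.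
  apply: continuous_bigsum => i.
  have c2 (F : one_form R n) (hF : hermitian_connection F) i' j :
      {for p0, continuous (fun p => 2 * abs1 (pairing F p v i' j))}.
    exact: continuousM (@cst_continuous _ _ (2 : R) p0) (cabs F hF i' j p0).
  exact: continuousD (c2 B hB i c) (c2 A hA a i).
exists (g p0 + 1).
have gl : \forall p \near p0, g p < g p0 + 1 by apply: (cvgr_lt _ cg);
  rewrite ltrDl.
apply: filterS gl => p gp vp; apply: (le_trans _ (ltW gp)).
have uu := gauge_unitary hA hB hS vp.
rewrite /gauge_rhs !mxE -sumrB; apply: (le_trans (abs1_sum _ _)).
apply: ler_sum => i _; apply: (le_trans (abs1D _ _)); rewrite abs1N.
apply: lerD; apply: (le_trans (abs1M _ _)).
  by rewrite ler_wpM2r ?abs1_ge0// unitary_abs1_le.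
by rewrite mulrC ler_wpM2r ?abs1_ge0// unitary_abs1_le.
Qed.

Lemma gauge_lipschitz p0 : visible eps0 p0 -> forall v b a c, exists C,
  increment_bound (fun y => part b (u y a c)) p0 v 0 C.
Proof.
move=> vis; apply: (null_directions_suffice vis).
- move=> v w hv hw b a c; have [C1 h1] := hv b a c; have [C2 h2] := hw b a c.
  by exists (C1 + C2); rewrite -[X in increment_bound _ _ _ X]addr0;
    exact: increment_boundD.
- move=> k v hv b a c; have [C1 h1] := hv b a c.
  by exists (C1 * `|k|); rewrite -[X in increment_bound _ _ _ X](mulr0 k);
    exact: increment_boundZ.
move=> v [dl dl0 Hd] b a c; have [C HC] := gauge_rhs_bounded p0 v a c.
exists C; move: HC => /nbhs_ballP[r /= r0 Hr].
apply: (@derive_increment_bound _ _ _ _ (fun p =>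
  part b (rhs p v a c)) v 0 C (Num.min dl r)).
  by rewrite lt_min dl0.
move=> p; rewrite lt_min => /andP[p1 p2]; have [vp dp] := Hd p p1.
split; first exact: part_derive.
rewrite subr0; apply: (le_trans (part_le _ _)).
by apply: Hr => //; rewrite -ball_normE/= distrC.
Qed.

Lemma gauge_continuous p0 b a c : visible eps0 p0 ->
  {for p0, continuous (fun y => part b (u y a c))}.
Proof.
move=> vis; apply: lipschitz_continuous_rV => v; exact: gauge_lipschitz.
Qed.

Lemma gauge_rhs_continuous p0 v b a c : visible eps0 p0 ->
  {for p0, continuous (fun p => part b (rhs p v a c))}.
Proof.
move=> vis.
have cu b' a' c' : {for p0, continuous (fun y => part b' (u y a' c'))}.
  exact: gauge_continuous.
have cF (F : one_form R n) (hF : hermitian_connection F) b' i j :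
    {for p0, continuous (fun p => part b' (pairing F p v i j))}.
  by case: b'; [exact: (Im_pairing_continuous hF (x := p0))
               |exact: (Re_pairing_continuous hF (x := p0))].
have cM (f g : spacetime R -> R[i]) :
    (forall b', {for p0, continuous (fun p => part b' (f p))}) ->
    (forall b', {for p0, continuous (fun p => part b' (g p))}) ->
    forall b', {for p0, continuous (fun p => part b' (f p * g p))}.
  move=> cf cg; case.
    rewrite (_ : (fun _ => _) = fun p => part false (f p) * part true (g p)
        + part true (f p) * part false (g p)); last by apply/funext => p;
          exact: Im_mul.
    exact: continuousD (continuousM (cf false) (cg true)) (continuousM (cf
      true) (cg false)).
  rewrite (_ : (fun _ => _) = fun p => part false (f p) * part false (g p)
      - part true (f p) * part true (g p)); last by apply/funext => p;
        exact: Re_mul.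
  exact: continuousB (continuousM (cf false) (cg false)) (continuousM (cf true)
    (cg true)).
have pB b' (z w : R[i]) : part b' (z - w) = part b' z - part b' w.
  by case: b'; rewrite /part ?Im_add ?Im_opp ?Re_add ?Re_opp.
have psum b' (f : 'I_n -> R[i]) : part b' (\sum_i f i) = \sum_i part b' (f i).
  by case: b'; [exact: Im_sum|exact: Re_sum].
rewrite (_ : (fun _ => _) = fun p => \sum_i (part b (u p a i * pairing B p v i c)
    - part b (pairing A p v a i * u p i c))); last first.
  by apply/funext => p; rewrite /gauge_rhs !mxE pB !psum sumrB.
apply: continuous_bigsum => i.
exact: continuousB (cM _ _ (fun b' => cu b' a i) (fun b' => cF B hB b' i c) b)
  (cM _ _ (fun b' => cF A hA b' a i) (fun b' => cu b' i c) b).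
Qed.

(** Now that u is continuous, so is the right-hand side of its equation: on a small ball it varies
    by at most [e], and for null directions [derive_increment_bound] applies. Quantifying over all
    [e] inside the property makes it stable under sums and multiples. *)
Lemma gauge_strict_derive p0 : visible eps0 p0 -> forall v b a c e, 0 < e ->
  increment_bound (fun y => part b (u y a c)) p0 v (part b (rhs p0 v a c)) e.
Proof.
move=> vis; apply: (null_directions_suffice vis).
- move=> v w hv hw b a c e e0; have e20 : 0 < e / 2 by rewrite divr_gt0.
  rewrite gauge_rhsD mxE partD [e]splitr.
  by apply: increment_boundD; [exact: hv|exact: hw].
- move=> k v hv b a c e e0; rewrite gauge_rhsZ mxE partZ.
  have k0 := normr_ge0 k; have k1 : 0 < 1 + `|k| by lra.
  apply: increment_bound_le (increment_boundZ k (hv b a c (e / (1 + `|k|)) _)).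
    rewrite mulrAC ler_pdivrMr//; nra.
  exact: divr_gt0.
move=> v [dl dl0 Hd] b a c e e0.
have cr : {for p0, continuous (fun p => part b (rhs p v a c))}.
  exact: gauge_rhs_continuous.
have : \forall p \near p0, `|part b (rhs p0 v a c) - part b (rhs p v a c)| <= e.
  exact: (@cvgrPdist_le _ _ _ (nbhs p0) (nbhs_filter p0) _ _).1 cr e e0.
move=> /nbhs_ballP[r /= r0 Hr].
apply: (@derive_increment_bound _ _ _ _ (fun p =>
  part b (rhs p v a c)) v _ e (Num.min dl r)).
  by rewrite lt_min dl0.
move=> p; rewrite lt_min => /andP[p1 p2]; have [vp dp] := Hd p p1.
split; first exact: part_derive.
by rewrite distrC; apply: Hr; rewrite -ball_normE/= distrC.
Qed.

Lemma gauge_derive p j : visible eps0 p ->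
  mx_is_derive p (basis_vec R j) u (u p *m B j p - A j p *m u p).
Proof.
move=> vis a c.
have d b : is_derive p (basis_vec R j) (fun y => part b (u y a c))
    (part b (rhs p (basis_vec R j) a c)).
  by apply: increment_bound_is_derive => e e0; exact: gauge_strict_derive.
by have := d false; have := d true; rewrite /gauge_rhs !pairing_basis.
Qed.

End gauge_regularity.

Theorem proposition2 (R : realType) (eps0 : R) (heps0 : 0 < eps0)
    (n : nat) (hn : (1 <= n)%N) (A B : one_form R n)
    (hA : hermitian_connection A) (hB : hermitian_connection B)
    (hS : forall eps : R, 0 < eps -> eps < eps0 ->
       forall x y z : spacetime R, broken_rays eps x y z ->
         broken_transform A z y x =1 broken_transform B z y x) :
  exists u : spacetime R -> 'M[R[i]]_n,
    [/\ mx_smooth_on (diamond eps0) u,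
        forall x, diamond eps0 x -> u x \is unitarymx,
        forall x, mho eps0 x -> u x = 1%:M
      & forall x, diamond eps0 x -> forall j : 'I_4,
          B j x = invmx (u x) *m mx_derive u x (basis_vec R j)
                  + invmx (u x) *m A j x *m u x].
Proof.
pose u := gauge eps0 A B.
have vis x : diamond eps0 x -> visible eps0 x by exact: diamond_visible.
have mho_diamond x : mho eps0 x -> diamond eps0 x.
  by move=> mx; exists x => //; exists x => //; split; left.
have uU x : diamond eps0 x -> u x \is unitarymx.
  by move=> /vis vx; apply/eqP; exact: (gauge_unitary hA hB hS).
(* Smoothness is established on the open set of visible points and then restricted to the diamond it
   contains. *)
have usmooth : mx_smooth_on (visible eps0) u.
  apply: (gauge_equation_smooth _ hA hB).
  - exact: visible_open.
  - move=> x a b vx; split.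
      exact: (gauge_continuous hA hB hS (b := false)).
    exact: (gauge_continuous hA hB hS (b := true)).
  - by move=> x j; exact: gauge_derive.
exists u; split=> //.
- move=> a b; have [sr si] := usmooth a b.
  by split=> k; apply: Ck_on_subset; [exact: vis|exact: sr|exact: vis|exact: si].
- by move=> x mx; apply: (gauge_mho hA hB hS) => //;
  exact: vis (mho_diamond x mx).
move=> x dx j.
have [_ ->] := (mx_is_deriveP _ _ _ _).1 (gauge_derive hA hB hS j (vis x dx)).
have uu : u x \in unitmx by apply: unitarymx_unit; exact: uU.
by rewrite mulmxBr mulKmx// !mulmxA subrK.
Qed.
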